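(* $\mathrm{TMC}^s$ restricted to splitjunction-free LTL formulas (formulas not containing $\vee$) is in $\mathrm{PSPACE}$.
   Context: Fix a finite set $AP$. Traces are elements of $(2^{AP})^\omega$, $t[i,\infty)=t(i)t(i+1)\cdots$; teams are sets of traces, $T[i,\infty)=\{t[i,\infty):t\in T\}$. LTL formulas: $\varphi::=p\mid\neg p\mid\varphi\wedge\varphi\mid\varphi\vee\varphi\mid X\varphi\mid F\varphi\mid G\varphi\mid\varphi U\varphi\mid\varphi R\varphi$ ($p\in AP$). Synchronous team semantics: $T\models_s p$ iff $p\in t(0)$ for all $t\in T$; $T\models_s\neg p$ iff $p\notin t(0)$ for all $t\in T$; $\wedge$ conjunctive; $T\models_s\psi\vee\varphi$ iff $T=T_1\cup T_2$ with $T_1\models_s\psi$, $T_2\models_s\varphi$; $T\models_s X\varphi$ iff $T[1,\infty)\models_s\varphi$; $T\models_s F\varphi$ iff $\exists k$: $T[k,\infty)\models_s\varphi$; $T\models_s G\varphi$ iff $\forall k$: $T[k,\infty)\models_s\varphi$; $T\models_s\psi U\varphi$ iff $\exists k$: $T[k,\infty)\models_s\varphi$ and $\forall k'<k$: $T[k',\infty)\models_s\psi$; $T\models_s\psi R\varphi$ iff $\forall k$: $T[k,\infty)\models_s\varphi$ or $\exists k'<k$: $T[k',\infty)\models_s\psi$. A Kripke structure $\mathcal K=(W,R,\eta,w_I)$: finite set $W$, left-total $R\subseteq W\times W$, labelling $\eta:W\to 2^{AP}$, initial world $w_I$; a path is $\pi\in W^\omega$ with $\pi(0)=w_I$ and $(\pi(i),\pi(i+1))\in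 R$; its trace is $\eta(\pi(0))\eta(\pi(1))\cdots$; $T(\mathcal K)$ is the set of traces of all paths. $\mathrm{TMC}^s$: given an LTL formula $\varphi$ and a Kripke structure $\mathcal K$, does $T(\mathcal K)\models_s\varphi$? *)

(* Defs.v *)
From Stdlib Require Import ZArith.
From HB Require Import structures.
From mathcomp Require Import all_boot.
Set Implicit Arguments. Unset Strict Implicit. Unset Printing Implicit Defensive.

Inductive ltl (AP : finType) : Type :=
| LAtom of AP
| LNAtom of AP
| LAnd of ltl AP & ltl AP
| LOr of ltl AP & ltl AP
| LX of ltl AP
| LF of ltl AP
| LG of ltl AP
| LU of ltl AP & ltl AP
| LR of ltl AP & ltl AP.

Fixpoint splitjunction_free (AP : finType) (f : ltl AP) : bool :=
  match f with
  | LAtom _ | LNAtom _ => true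
  | LAnd a b | LU a b | LR a b => splitjunction_free a && splitjunction_free b
  | LOr _ _ => false
  | LX a | LF a | LG a => splitjunction_free a
  end.

Definition trace (AP : finType) := nat -> {set AP}.
Definition team (AP : finType) := trace AP -> Prop.

Definition suffix (AP : finType) (k : nat) (t : trace AP) : trace AP :=
  fun i => t (k + i).
Definition team_suffix (AP : finType) (k : nat) (T : team AP) : team AP :=
  fun s => exists t, T t /\ s = suffix k t.

Fixpoint sat_s (AP : finType) (f : ltl AP) : team AP -> Prop :=
  match f with
  | LAtom p => fun T => forall t, T t -> p \in t 0
  | LNAtom p => fun T => forall t, T t -> p \notin t 0
  | LAnd a b => fun T => sat_s a T /\ sat_s b T
  | LOr a b => fun T => exists T1 T2 : team AP,
      (forall t, T t <-> T1 t \/ T2 t) /\ sat_s a T1 /\ sat_s b T2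
  | LX a => fun T => sat_s a (team_suffix 1 T)
  | LF a => fun T => exists k, sat_s a (team_suffix k T)
  | LG a => fun T => forall k, sat_s a (team_suffix k T)
  | LU a b => fun T => exists k, sat_s b (team_suffix k T) /\
      forall k', k' < k -> sat_s a (team_suffix k' T)
  | LR a b => fun T => forall k, sat_s b (team_suffix k T) \/
      exists k', k' < k /\ sat_s a (team_suffix k' T)
  end.

(* Kripke structures: worlds 'I_kn (finite, nonempty since kinit).     *)
Record kripke (AP : finType) := Kripke {
  kn : nat;
  krel : 'I_kn -> 'I_kn -> bool;
  klab : 'I_kn -> {set AP};
  kinit : 'I_kn }.
Arguments krel {AP} k _ _.
Arguments klab {AP} k _.
Arguments kinit {AP} k.
Arguments kn {AP} k.

Definition left_total (AP : finType) (K : kripke AP) : Prop :=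
  forall w, exists v, krel K w v.

Definition traces_of (AP : finType) (K : kripke AP) : team AP :=
  fun t => exists pi : nat -> 'I_(kn K),
    pi 0 = kinit K /\ (forall i, krel K (pi i) (pi i.+1)) /\
    (forall i, t i = klab K (pi i)).

Inductive tok := TAtom | TNAtom | TAnd | TOr | TX | TF | TG | TU | TR
               | TOne | TZero | TSep.

Definition tok_to (t : tok) : 'I_12 :=
  inord (match t with TAtom => 0 | TNAtom => 1 | TAnd => 2 | TOr => 3
   | TX => 4 | TF => 5 | TG => 6 | TU => 7 | TR => 8 | TOne => 9
   | TZero => 10 | TSep => 11 end).
Definition tok_of (i : 'I_12) : tok :=
  match val i with 0 => TAtom | 1 => TNAtom | 2 => TAnd | 3 => TOr
   | 4 => TX | 5 => TF | 6 => TG | 7 => TU | 8 => TR | 9 => TOne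
   | 10 => TZero | _ => TSep end.
Lemma tok_toK : cancel tok_to tok_of.
Proof. by case; rewrite /tok_of /= inordK. Qed.
HB.instance Definition _ := Finite.copy tok (can_type tok_toK).

Definition unary (n : nat) : seq tok := rcons (nseq n TOne) TSep.
Definition bit (b : bool) : tok := if b then TOne else TZero.

Fixpoint enc_ltl (AP : finType) (f : ltl AP) : seq tok :=
  match f with
  | LAtom p => TAtom :: unary (enum_rank p)
  | LNAtom p => TNAtom :: unary (enum_rank p)
  | LAnd a b => TAnd :: enc_ltl a ++ enc_ltl b
  | LOr a b => TOr :: enc_ltl a ++ enc_ltl b
  | LX a => TX :: enc_ltl a
  | LF a => TF :: enc_ltl a
  | LG a => TG :: enc_ltl a
  | LU a b => TU :: enc_ltl a ++ enc_ltl b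
  | LR a b => TR :: enc_ltl a ++ enc_ltl b
  end.

Definition enc_kripke (AP : finType) (K : kripke AP) : seq tok :=
  unary (kn K) ++ unary (kinit K) ++
  [seq bit (krel K i j) | i <- enum 'I_(kn K), j <- enum 'I_(kn K)] ++
  [seq bit (a \in klab K i) | i <- enum 'I_(kn K), a <- enum AP].

Definition enc_instance (AP : finType) (f : ltl AP) (K : kripke AP) :=
  enc_ltl f ++ enc_kripke K.

Definition TMCs_splitjunction_free (AP : finType) : seq tok -> Prop :=
  fun w => exists (f : ltl AP) (K : kripke AP),
    w = enc_instance f K /\ left_total K /\ splitjunction_free f /\
    sat_s f (traces_of K).

Inductive move := MLeft | MRight | MStay.

Record TM (Sigma : finType) := {
  tm_state : finType;
  tm_work : finType;
  tm_start : tm_state;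
  tm_acc : tm_state;
  tm_rej : tm_state;
  tm_delta : tm_state -> option (Sigma + tm_work) ->
             tm_state * option (Sigma + tm_work) * move }.
(* tape symbols are option (Sigma + work); None is the blank *)

Definition config (Sigma : finType) (M : TM Sigma) : Type :=
  (tm_state M * (Z -> option (Sigma + tm_work M)) * Z)%type.

Definition move_dir (m : move) : Z :=
  match m with MLeft => (-1)%Z | MRight => 1%Z | MStay => 0%Z end.

Definition tm_halted (Sigma : finType) (M : TM Sigma) (q : tm_state M) : bool :=
  (q == tm_acc M) || (q == tm_rej M).

Definition tm_step (Sigma : finType) (M : TM Sigma) (c : config M) : config M :=
  let: (q, tp, h) := c in
  if tm_halted q then c else
  let: (q', a, mv) := tm_delta q (tp h) in
  (q', (fun i => if Z.eqb i h then a else tp i), (h + move_dir mv)%Z).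

Definition tm_init (Sigma : finType) (M : TM Sigma) (w : seq Sigma) : config M :=
  (tm_start M,
   (fun i : Z => if (0 <=? i)%Z
                 then nth None [seq Some (inl a) | a <- w] (Z.to_nat i)
                 else None),
   0%Z).

Definition tm_run (Sigma : finType) (M : TM Sigma) (w : seq Sigma) (k : nat)
  : config M := iter k (@tm_step Sigma M) (tm_init M w).

Definition cfg_state (Sigma : finType) (M : TM Sigma) (c : config M) :=
  c.1.1.
Definition cfg_head (Sigma : finType) (M : TM Sigma) (c : config M) := c.2.

Definition tm_decides (Sigma : finType) (M : TM Sigma) (L : seq Sigma -> Prop) :=
  forall w, (exists k, tm_halted (cfg_state (tm_run M w k))) /\
            (L w <-> exists k, cfg_state (tm_run M w k) = tm_acc M).

Definition in_PSPACE (Sigma : finType) (L : seq Sigma -> Prop) : Prop :=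
  exists (M : TM Sigma) (c : nat), tm_decides M L /\
    forall w k, (Z.abs (cfg_head (tm_run M w k)) <=
                 Z.of_nat (c * size w ^ c + c))%Z.

(* Main.v *)
(* Without splitjunction a team T(K)[k,oo) only enters through the set S_k of worlds
   reachable in exactly k steps, and S_(k+1) is determined by S_k. Since there are only
   2^n world sets, an until that holds has a witness within the next 2^n positions.
   For each token position i of the formula, the truth value at time k of the subformula
   starting there is obtained by one sweep backwards from time |w| 2^|w|: the temporal
   operator at i is reset to its default value at all times from (i+1) 2^|w| on, and its
   value is then correct at all times up to i 2^|w|. The reset of an outer operator thus
   comes one full window before the values of its operands become unreliable. The sweep
   stores one bit per position and recomputes S_k, at the price of exponential time.

   Polynomial space is obtained through counter programs whose registers stay below
   2^poly: a Turing machine keeps register j as a binary number on track j of its tape,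
   and such programs are closed under recursion with 2^poly bounded values, hence
   under bounded quantification and search. *)
Require Import Defs.
From Stdlib Require Import ZArith FunctionalExtensionality PropExtensionality.
From Stdlib Require Import ClassicalEpsilon.
From mathcomp Require Import all_boot.
From mathcomp Require Import zify.
Set Implicit Arguments. Unset Strict Implicit. Unset Printing Implicit Defensive.

(** * Counter programs on a one-tape machine *)

(** Since only space is charged, every object with a bitwise description (a world set, a vector of
    truth values, a parse of the formula, the packed input) is found by exhaustive search below a
    bound instead of being constructed. The search bounds must themselves be computed, and an
    exponential is affordable only if its exponent is polynomial in the input length; hence
    [2 ^ |w|] and one larger bound with quadratic exponent are computed once and passed along. A
    recursion over the formula would need a stack, with one time counter for each nested temporal
    operator, whereas a program has a fixed set of registers. Sweeping over time with all token
    positions evaluated together replaces that recursion by a single loop. The price is that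
    unbounded operators must be started at a finite time, which is what the staggered resets take
    care of. *)

Definition upd (s : nat -> nat) (i v : nat) : nat -> nat :=
  fun j => if j == i then v else s j.

Inductive prog :=
| PInc of nat
| PDec of nat
| PSeq of prog & prog
| PWhile of nat & prog.

(** Big-step, so that a derivation includes termination. The guard of [RunInc] is the only place
    where [B] enters; with [B = 2 ^ E] an incremented register still fits into [E] bits. *)
Inductive run (B : nat) : prog -> (nat -> nat) -> (nat -> nat) -> Prop :=
| RunInc i s : (s i).+1 < B -> run B (PInc i) s (upd s i (s i).+1)
| RunDec i s : 0 < s i -> run B (PDec i) s (upd s i (s i).-1)
| RunSeq p q s1 s2 s3 : run B p s1 s2 -> run B q s2 s3 -> run B (PSeq p q) s1 s3
| RunWhile0 i p s : s i = 0 -> run B (PWhile i p) s s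
| RunWhileS i p s1 s2 s3 : 0 < s1 i -> run B p s1 s2 ->
    run B (PWhile i p) s2 s3 -> run B (PWhile i p) s1 s3.

Fixpoint regs_below (r : nat) (p : prog) : bool :=
  match p with
  | PInc i | PDec i => i < r
  | PSeq p q => regs_below r p && regs_below r q
  | PWhile i p => (i < r) && regs_below r p
  end.

Lemma regs_below_mono r r' p : r <= r' -> regs_below r p -> regs_below r' p.
Proof.
move=> rr'; elim: p => /= [i|i|p IHp q IHq|i p IHp].
- by move=> /leq_trans; apply.
- by move=> /leq_trans; apply.
- by move=> /andP[/IHp-> /IHq->].
- by move=> /andP[ir /IHp->]; rewrite andbT (leq_trans ir).
Qed.

Lemma regs_belowE p : exists r, regs_below r p.
Proof.
elim: p => [i|i|p [r1 H1] q [r2 H2]|i p [r1 H1]].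
- by exists i.+1 => /=.
- by exists i.+1 => /=.
- exists (maxn r1 r2) => /=.
  by rewrite !(regs_below_mono _ H1, regs_below_mono _ H2) ?leq_maxl ?leq_maxr.
- exists (maxn r1 i.+1) => /=.
  by rewrite (regs_below_mono _ H1) ?leq_maxl // andbT leq_max leqnn orbT.
Qed.

Inductive instr := IInc of nat | IDec of nat | IJz of nat & nat | IJmp of nat.

(** Jump targets are absolute and [a] is the address of the first emitted instruction. The [.+2]
    skips the test and the jump back. *)
Fixpoint compile (a : nat) (p : prog) : seq instr :=
  match p with
  | PInc i => [:: IInc i]
  | PDec i => [:: IDec i]
  | PSeq p q => let c := compile a p in c ++ compile (a + size c) q
  | PWhile i p => let c := compile a.+1 p in
      IJz i (a + size c).+2 :: c ++ [:: IJmp a]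
  end.

(** * A Turing machine with one binary number per track *)

Section Machine.
Variables (Sigma : finType) (idx : Sigma -> nat) (r : nat).

Notation work := {ffun 'I_r -> bool}.
Notation cell := (Sigma + work)%type.
Notation sym := (option cell).

(* An input letter [a] is read as the column whose only nonzero bit is on track [idx a]. *)
Definition track (c : cell) (j : nat) : bool :=
  match c with
  | inl a => idx a == j
  | inr v => if (insub j : option 'I_r) is Some i then v i else false
  end.

Definition set_track (j : nat) (b : bool) (c : cell) : cell :=
  inr [ffun i : 'I_r => if val i == j then b else track c i].

Arguments track : simpl never.
Arguments set_track : simpl never.

Definition blank_cell : cell := inr [ffun _ : 'I_r => false].

Lemma track_set j b c j' : j' < r ->
  track (set_track j b c) j' = if j' == j then b else track c j'.
Proof. move=> lt; rewrite /set_track {1}/track.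
by case: insubP => [i _ <-|]; [rewrite ffunE | rewrite lt]. Qed.

Lemma track_blank j : track blank_cell j = false.
Proof. by rewrite /blank_cell /track; case: insubP => // i _ _; rewrite ffunE. Qed.

(** Least significant bit first: carries and borrows travel away from cell 0, towards the end where
    the tape can grow. *)
Definition tval (j : nat) (cs : seq cell) : nat :=
  foldr (fun c acc => track c j + acc.*2) 0 cs.

Fixpoint inc_cells (j : nat) (cs : seq cell) : seq cell :=
  match cs with
  | [::] => [:: set_track j true blank_cell]
  | c :: cs' => if track c j then set_track j false c :: inc_cells j cs'
                else set_track j true c :: cs'
  end.

Fixpoint dec_cells (j : nat) (cs : seq cell) : seq cell :=
  match cs with
  | [::] => [::]
  | c :: cs' => if track c j then set_track j false c :: cs'
                else set_track j true c :: dec_cells j cs'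
  end.

Lemma tval_inc j j' cs : j < r -> j' < r ->
  tval j' (inc_cells j cs) = if j' == j then (tval j cs).+1 else tval j' cs.
Proof.
move=> jr jr'; elim: cs => [|c cs IH] /=.
  by rewrite track_set // track_blank; case: eqP.
have [tc|tc] := boolP (track c j) => /=; rewrite ?track_set // ?IH //.
- by case: eqP => [_|//]; lia.
- by case: eqP => [->|//]; lia.
Qed.

Lemma tval_dec j j' cs : j < r -> j' < r -> 0 < tval j cs ->
  tval j' (dec_cells j cs) = if j' == j then (tval j cs).-1 else tval j' cs.
Proof.
move=> jr jr'; elim: cs => [|c cs IH] //=.
have [tc|tc] := boolP (track c j) => /=; rewrite ?track_set // => H.
- by case: eqP => [->|//]; move: H; rewrite ?tc; lia.
- rewrite IH; last by move: H; lia.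
  by case: eqP => [_|//]; rewrite ?(negbTE tc); move: H; lia.
Qed.

(** A cell is appended only when track [j] consists of ones; the new value is then 2 to the old
    length, so that length is below [E]. The maximum is there because other tracks may be longer. *)
Lemma size_inc_cells j cs E : j < r -> (tval j cs).+1 < 2 ^ E ->
  size (inc_cells j cs) <= maxn (size cs) E.
Proof.
move=> jr; elim: cs E => [|c cs IH] [|E] //=; rewrite ?expn0 ?expnS; try lia.
case: track => /=; try lia.
move=> H; have := IH E; lia.
Qed.

Lemma size_dec_cells j cs : size (dec_cells j cs) = size cs.
Proof. by elim: cs => //= c cs IH; case: track; rewrite /= ?IH. Qed.

Definition tape (cs : seq cell) : Z -> sym :=
  fun z => if (0 <=? z)%Z then nth None [seq Some c | c <- cs] (Z.to_nat z)
           else None.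

Definition wr (tp : Z -> sym) (h : Z) (a : sym) : Z -> sym :=
  fun i => if Z.eqb i h then a else tp i.

Lemma wr_id tp h : wr tp h (tp h) = tp.
Proof. by apply: functional_extensionality => z; rewrite /wr; case: Z.eqb_spec => [->|]. Qed.

Lemma tape_end cs : tape cs (Z.of_nat (size cs)) = None.
Proof.
rewrite /tape; case: Z.leb_spec => // _.
by rewrite Nat2Z.id nth_default // size_map.
Qed.

Lemma tape_mid pre c suf :
  tape (pre ++ c :: suf) (Z.of_nat (size pre)) = Some c.
Proof.
rewrite /tape; case: Z.leb_spec => [_|]; last lia.
by rewrite Nat2Z.id map_cat nth_cat size_map ltnn subnn.
Qed.

Lemma tape_neg cs : tape cs (-1) = None.
Proof. by []. Qed.

Lemma tape_lt cs n : n < size cs -> exists c, tape cs (Z.of_nat n) = Some c.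
Proof.
move=> lt; rewrite /tape; case: Z.leb_spec => [_|]; last lia.
rewrite Nat2Z.id; case: cs lt => // c cs lt.
by exists (nth c (c :: cs) n); rewrite (nth_map c).
Qed.

Lemma wr_mid pre c c' suf :
  wr (tape (pre ++ c :: suf)) (Z.of_nat (size pre)) (Some c') =
  tape (rcons pre c' ++ suf).
Proof.
apply: functional_extensionality => z; rewrite /wr /tape.
case: Z.eqb_spec => [->|ne].
  case: Z.leb_spec => [_|]; last lia.
  by rewrite Nat2Z.id map_cat nth_cat size_map size_rcons leqnn map_rcons
             nth_rcons size_map ltnn eqxx.
case: Z.leb_spec => // le0.
rewrite cat_rcons !map_cat !nth_cat !size_map; case: ifP => // ge.
by case E: (Z.to_nat z - size pre) => [|m] //=; lia.
Qed.

Lemma wr_end pre c' :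
  wr (tape pre) (Z.of_nat (size pre)) (Some c') = tape (rcons pre c').
Proof.
apply: functional_extensionality => z; rewrite /wr /tape.
case: Z.eqb_spec => [->|ne].
  case: Z.leb_spec => [_|]; last lia.
  by rewrite Nat2Z.id map_rcons nth_rcons size_map ltnn eqxx.
case: Z.leb_spec => // le0.
rewrite map_rcons nth_rcons size_map; case: ifP => // ge.
by rewrite nth_default ?size_map; [case: ifP => //; lia | lia].
Qed.

Variable code : seq instr.
Notation N := (size code).
Notation state := (bool * 'I_N.+2)%type.

Definition pc_state (ret : bool) (pc : nat) : state := (ret, inord pc).

(* In phase [true] the head walks back to the cell -1, which is always blank. *)
Definition counter_delta (q : state) (a : sym) : state * sym * move :=
  if q.1 then
    (if a is None then ((false, q.2), None, MRight) else (q, a, MLeft))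
  else
    let next := pc_state true (q.2).+1 in
    match nth (IJmp 0) code q.2 with
    | IInc j => if a is Some c then
          (if track c j then (q, Some (set_track j false c), MRight)
           else (next, Some (set_track j true c), MLeft))
        else (next, Some (set_track j true blank_cell), MLeft)
    | IDec j => if a is Some c then
          (if track c j then (next, Some (set_track j false c), MLeft)
           else (q, Some (set_track j true c), MRight))
        else (next, None, MLeft)
    | IJz j t => if a is Some c then
          (if track c j then (next, a, MLeft) else (q, a, MRight))
        else (pc_state true t, None, MLeft)
    | IJmp t => (pc_state true t, a, MLeft)
    end.

(** The two addresses just past the code serve as accepting and rejecting state, both in phase
    [false], so the walk back is completed before the machine halts. *)
Definition counter_tm : TM Sigma :=
  {| tm_state := state; tm_work := work;
     tm_start := pc_state false 0;
     tm_acc := pc_state false N; tm_rej := pc_state false N.+1;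
     tm_delta := counter_delta |}.

Notation cfg := (config counter_tm).
Definition mkcfg (ret : bool) (pc : nat) (cs : seq cell) (h : Z) : cfg :=
  (pc_state ret pc : tm_state counter_tm, tape cs : Z -> option (Sigma + tm_work counter_tm), h).

Lemma head_mkcfg ret pc cs h : cfg_head (mkcfg ret pc cs h) = h.
Proof. by []. Qed.

Definition reach (D : nat) (c c' : cfg) : Prop :=
  exists n, iter n (@tm_step _ _) c = c' /\
    forall k, k <= n ->
      (Z.abs (cfg_head (iter k (@tm_step _ _) c)) <= Z.of_nat D)%Z.

Lemma reach_refl D c : (Z.abs (cfg_head c) <= Z.of_nat D)%Z -> reach D c c.
Proof. by exists 0; split=> // k; rewrite leqn0 => /eqP->. Qed.

Lemma reach_trans D c1 c2 c3 : reach D c1 c2 -> reach D c2 c3 -> reach D c1 c3.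
Proof.
move=> [n [e1 b1]] [m [e2 b2]]; exists (m + n); split.
  by rewrite iterD e1.
move=> k km; have [kn|nk] := leqP k n; first exact: b1.
have -> : k = (k - n) + n by lia.
by rewrite iterD e1; apply: b2; lia.
Qed.

Lemma reach_step D c c' : (Z.abs (cfg_head c) <= Z.of_nat D)%Z ->
  reach D (tm_step c) c' -> reach D c c'.
Proof.
move=> bc [n [e b]]; exists n.+1; split; first by rewrite iterSr.
by move=> [|k] kn //; rewrite iterSr; apply: b.
Qed.

Lemma stepE q tp h : q != tm_acc counter_tm -> q != tm_rej counter_tm ->
  @tm_step _ counter_tm (q, tp, h) =
  let: (q', a, mv) := counter_delta q (tp h) in
  (q', wr tp h a, (h + move_dir mv)%Z).
Proof. by move=> qa qr; rewrite /tm_step /tm_halted (negbTE qa) (negbTE qr). Qed.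

Lemma pc_stateE ret pc : pc < N.+2 -> (pc_state ret pc).2 = pc :> nat.
Proof. by move=> lt; rewrite /= inordK. Qed.

Lemma state_neq ret pc pc' : pc < N.+2 -> pc' < N.+2 -> ret || (pc != pc') ->
  pc_state ret pc != pc_state false pc'.
Proof.
move=> l l'; apply: contraTN => /eqP[-> /(congr1 val)] /=.
by rewrite !inordK // => ->; rewrite eqxx.
Qed.

Lemma step_ret_move pc cs n c : pc < N.+2 -> tape cs (Z.of_nat n) = Some c ->
  tm_step (mkcfg true pc cs (Z.of_nat n)) = mkcfg true pc cs (Z.of_nat n - 1)%Z.
Proof.
move=> lt e; rewrite /mkcfg stepE ?state_neq // /counter_delta /= e.
by rewrite -e wr_id.
Qed.

Lemma step_ret_end pc cs : pc < N.+2 ->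
  tm_step (mkcfg true pc cs (-1)) = mkcfg false pc cs 0.
Proof.
move=> lt; rewrite /mkcfg stepE ?state_neq // /counter_delta /=.
by rewrite -(tape_neg cs) wr_id.
Qed.

Lemma reach_ret D pc cs n : pc < N.+2 -> n <= size cs -> size cs < D ->
  reach D (mkcfg true pc cs (Z.of_nat n - 1)%Z) (mkcfg false pc cs 0).
Proof.
move=> lt; elim: n => [|n IH] ns sD.
  apply: reach_step; first by rewrite head_mkcfg; lia.
  rewrite -[(Z.of_nat 0 - 1)%Z]/(-1)%Z step_ret_end //.
  by apply: reach_refl; rewrite head_mkcfg; lia.
have [c ec] := tape_lt ns.
have -> : (Z.of_nat n.+1 - 1 = Z.of_nat n)%Z by lia.
apply: reach_step; first by rewrite head_mkcfg; lia.
by rewrite (step_ret_move lt ec); apply: IH => //; lia.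
Qed.

Definition instr_at pc i := (pc < N) /\ nth (IJmp 0) code pc = i.

Lemma step_exec pc cs n i : instr_at pc i ->
  tm_step (mkcfg false pc cs (Z.of_nat n)) =
  let: (q', a, mv) := counter_delta (pc_state false pc) (tape cs (Z.of_nat n)) in
  (q' : tm_state counter_tm, wr (tape cs) (Z.of_nat n) a, (Z.of_nat n + move_dir mv)%Z).
Proof.
by move=> [lt _]; rewrite /mkcfg stepE // state_neq //=; lia.
Qed.

(** The split of the tape is the invariant of the scan: [pre] has been passed and rewritten, and the
    head stands on the first cell of [suf]. *)
Lemma reach_inc D pc j pre suf : instr_at pc (IInc j) ->
  size (pre ++ inc_cells j suf) < D ->
  reach D (mkcfg false pc (pre ++ suf) (Z.of_nat (size pre)))
          (mkcfg false pc.+1 (pre ++ inc_cells j suf) 0).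
Proof.
move=> at_pc; have [lt ei] := at_pc.
elim: suf pre => [|c suf IH] pre /=; rewrite ?cats0 => sD.
  apply: reach_step; first by rewrite head_mkcfg; move: sD; rewrite size_cat; lia.
  rewrite (step_exec _ _ at_pc) tape_end /counter_delta pc_stateE ?ei; last lia.
  rewrite /= wr_end cats1 -[(_ + -1)%Z]/(Z.of_nat _ - 1)%Z.
  apply: reach_ret; rewrite ?size_rcons ?ltnS //; move: sD; rewrite size_cat /=; lia.
case: ifP sD => tc sD.
  apply: reach_step; first by rewrite head_mkcfg; move: sD; rewrite size_cat /=; lia.
  rewrite (step_exec _ _ at_pc) tape_mid /counter_delta pc_stateE ?ei; last lia.
  rewrite tc /= wr_mid -cat_rcons.
  have -> : (Z.of_nat (size pre) + 1 = Z.of_nat (size (rcons pre (set_track j false c))))%Z.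
    by rewrite size_rcons; lia.
  by apply: IH; rewrite cat_rcons.
apply: reach_step; first by rewrite head_mkcfg; move: sD; rewrite size_cat /=; lia.
rewrite (step_exec _ _ at_pc) tape_mid /counter_delta pc_stateE ?ei; last lia.
rewrite tc /= wr_mid -cat_rcons -[(_ + -1)%Z]/(Z.of_nat _ - 1)%Z.
by apply: reach_ret; rewrite ?size_cat ?size_rcons //; move: sD; rewrite ?size_cat /=; lia.
Qed.

Lemma reach_dec D pc j pre suf : instr_at pc (IDec j) ->
  size (pre ++ suf) < D ->
  reach D (mkcfg false pc (pre ++ suf) (Z.of_nat (size pre)))
          (mkcfg false pc.+1 (pre ++ dec_cells j suf) 0).
Proof.
move=> at_pc; have [lt ei] := at_pc.
elim: suf pre => [|c suf IH] pre /=; rewrite ?cats0 => sD.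
  apply: reach_step; first by rewrite head_mkcfg; lia.
  rewrite (step_exec _ _ at_pc) tape_end /counter_delta pc_stateE ?ei; last lia.
  rewrite /= -(tape_end pre) wr_id -[(_ + -1)%Z]/(Z.of_nat _ - 1)%Z.
  by apply: reach_ret => //; move: sD; rewrite ?size_cat /=; lia.
apply: reach_step; first by rewrite head_mkcfg; move: sD; rewrite size_cat /=; lia.
rewrite (step_exec _ _ at_pc) tape_mid /counter_delta pc_stateE ?ei; last lia.
case: ifP => tc.
  rewrite wr_mid -cat_rcons -[(_ + _)%Z]/(Z.of_nat _ - 1)%Z.
  by apply: reach_ret; rewrite ?size_cat ?size_rcons //; move: sD; rewrite ?size_cat /=; lia.
rewrite /= wr_mid -cat_rcons.
have -> : (Z.of_nat (size pre) + 1 = Z.of_nat (size (rcons pre (set_track j true c))))%Z.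
  by rewrite size_rcons; lia.
by apply: IH; move: sD; rewrite !size_cat size_rcons /=; lia.
Qed.

Lemma reach_jz D pc j t pre suf : instr_at pc (IJz j t) -> t < N.+2 ->
  size (pre ++ suf) < D ->
  reach D (mkcfg false pc (pre ++ suf) (Z.of_nat (size pre)))
          (mkcfg false (if tval j suf == 0 then t else pc.+1) (pre ++ suf) 0).
Proof.
move=> at_pc tN; have [lt ei] := at_pc.
elim: suf pre => [|c suf IH] pre /=; rewrite ?cats0 => sD.
  apply: reach_step; first by rewrite head_mkcfg; lia.
  rewrite (step_exec _ _ at_pc) tape_end /counter_delta pc_stateE ?ei; last lia.
  rewrite /= -(tape_end pre) wr_id -[(_ + -1)%Z]/(Z.of_nat _ - 1)%Z.
  by apply: reach_ret => //; move: sD; rewrite ?size_cat /=; lia.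
apply: reach_step; first by rewrite head_mkcfg; move: sD; rewrite size_cat /=; lia.
rewrite (step_exec _ _ at_pc) tape_mid /counter_delta pc_stateE ?ei; last lia.
case: ifP => tc.
  rewrite /= -(tape_mid pre c suf) wr_id -[(_ + _)%Z]/(Z.of_nat _ - 1)%Z.
  by apply: reach_ret; rewrite ?size_cat ?size_rcons //; move: sD; rewrite ?size_cat /=; lia.
rewrite /= -(tape_mid pre c suf) wr_id add0n double_eq0 -cat_rcons.
have -> : (Z.of_nat (size pre) + 1 = Z.of_nat (size (rcons pre c)))%Z.
  by rewrite size_rcons; lia.
by apply: IH; rewrite cat_rcons.
Qed.

Lemma reach_jmp D pc t cs : instr_at pc (IJmp t) -> t < N.+2 -> size cs < D ->
  reach D (mkcfg false pc cs 0) (mkcfg false t cs 0).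
Proof.
move=> at_pc tN sD; have [lt ei] := at_pc.
apply: reach_step; first by rewrite head_mkcfg; lia.
rewrite (step_exec cs 0 at_pc) /counter_delta pc_stateE ?ei /=; last lia.
by rewrite wr_id; apply: (reach_ret (n := 0)).
Qed.

Definition rep (cs : seq cell) (s : nat -> nat) : Prop :=
  forall j, j < r -> tval j cs = s j.

Definition code_at (a : nat) (c : seq instr) : Prop :=
  a + size c <= N /\ forall k, k < size c ->
    nth (IJmp 0) code (a + k) = nth (IJmp 0) c k.

Lemma code_at_cat a c1 c2 : code_at a (c1 ++ c2) <->
  code_at a c1 /\ code_at (a + size c1) c2.
Proof.
rewrite /code_at size_cat; split.
  move=> [le H]; split; split=> [|k kc]; try lia.
    by rewrite H ?nth_cat ?kc //; lia.
  rewrite -addnA H ?nth_cat; last lia.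
  by rewrite ltnNge leq_addr /= addKn.
move=> [[le1 H1] [le2 H2]]; split=> [|k kc]; first lia.
rewrite nth_cat; case: ltnP => [|ge]; first exact: H1.
by rewrite -H2; [congr nth|]; lia.
Qed.

Lemma code_at1 a i : code_at a [:: i] -> instr_at a i.
Proof. by move=> [le H]; split; [move: le => /=; lia | have := H 0 isT; rewrite addn0]. Qed.

(** Induction on the derivation of the run, so that the remaining rounds of a loop are a
    subderivation at the same address. Only increments lengthen the tape, and their results stay
    below [2 ^ E]. *)
Lemma run_reach E D p s s' : run (2 ^ E) p s s' -> E < D ->
  forall a cs, code_at a (compile a p) -> regs_below r p -> rep cs s ->
  size cs < D ->
  exists cs', [/\ rep cs' s', size cs' < D &
    reach D (mkcfg false a cs 0)
            (mkcfg false (a + size (compile a p)) cs' 0)].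
Proof.
move=> H ED; elim: H => {p s s'}.
- move=> i s lt a cs /= /code_at1 ca ir rp sD.
  exists (inc_cells i cs); split.
  + by move=> j jr; rewrite tval_inc // /upd !rp.
  + have := @size_inc_cells i cs E ir; rewrite rp // => /(_ lt); lia.
  + rewrite addn1; apply: (reach_inc (pre := [::])) => //=.
    have := @size_inc_cells i cs E ir; rewrite rp // => /(_ lt); lia.
- move=> i s lt a cs /= /code_at1 ca ir rp sD.
  exists (dec_cells i cs); split; rewrite ?size_dec_cells //.
  + by move=> j jr; rewrite tval_dec // /upd ?rp //.
  + by rewrite addn1; apply: (reach_dec (pre := [::])).
- move=> p q s1 s2 s3 _ IH1 _ IH2 a cs /= /code_at_cat[c1 c2] /andP[r1 r2] rp sD.
  have [cs1 [rp1 sD1 re1]] := IH1 _ _ c1 r1 rp sD.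
  have [cs2 [rp2 sD2 re2]] := IH2 _ _ c2 r2 rp1 sD1.
  exists cs2; split=> //; rewrite size_cat addnA.
  exact: reach_trans re1 re2.
- move=> i p s s0 a cs /= ca /andP[ir rgp] rp sD.
  exists cs; split=> //.
  have [_] := ca; have [le _] := ca.
  move: ca; rewrite -cat1s => /code_at_cat[/code_at1 c1 _] _.
  have -> : a + (size (compile a.+1 p ++ [:: IJmp a])).+1 =
            if tval i cs == 0 then (a + size (compile a.+1 p)).+2 else a.+1.
    by rewrite rp // s0 eqxx size_cat /=; lia.
  by apply: (reach_jz (pre := [::]) c1) => //; move: le; rewrite /= size_cat /=; lia.
- move=> i p s1 s2 s3 s0 _ IH1 _ IH2 a cs ca rg rp sD.
  have /andP[ir rgp] := rg.
  have [le _] := ca; move: (ca); rewrite /= -cat1s.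
  move=> /code_at_cat[/code_at1 c1 /code_at_cat[c2 /code_at1 c3]].
  move: c2 c3; rewrite /= addn1 => c2 c3.
  have [cs1 [rp1 sD1 re1]] := IH1 _ _ c2 rgp rp sD.
  have [cs2 [rp2 sD2 re2]] := IH2 _ _ ca rg rp1 sD1.
  exists cs2; split=> //; apply: reach_trans re2.
  have re0 : reach D (mkcfg false a cs 0) (mkcfg false a.+1 cs 0).
    have := @reach_jz D a i _ [::] cs c1 _ sD.
    rewrite /= rp // -[s1 i == 0]negbK -lt0n s0; apply.
    by move: le; rewrite /= size_cat /=; lia.
  apply: reach_trans re0 (reach_trans re1 _).
  by apply: reach_jmp => //; move: le; rewrite /=; lia.
Qed.

End Machine.

Lemma halted_iter (Sigma : finType) (M : TM Sigma) (c : config M) n :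
  tm_halted (cfg_state c) -> iter n (@tm_step _ M) c = c.
Proof.
by case: c => [[q tp] h] /= Hq; elim: n => //= n ->; rewrite /tm_step Hq.
Qed.

Lemma expn_leW m n e : m <= n -> m ^ e <= n ^ e.
Proof. by case: e => // e mn; rewrite leq_exp2r. Qed.

(** [in_PSPACE] uses one constant as factor, exponent and summand. For [n] at least 2 the factor
    absorbs the shift by 2; for smaller [n] the summand alone suffices. *)
Lemma expn_poly n e : (n + 2) ^ e <= 4 ^ e * n ^ (4 ^ e) + 4 ^ e.
Proof.
have le4 : e <= 4 ^ e by apply: ltnW; apply: ltn_expl.
case: n => [|[|n]].
- by rewrite (leq_trans _ (leq_addl _ _)) // expn_leW.
- by rewrite (leq_trans _ (leq_addl _ _)) // expn_leW.
apply: leq_trans (leq_addr _ _).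
apply: (@leq_trans ((4 * n.+2) ^ e)).
  by apply: expn_leW; lia.
by rewrite expnMn leq_mul2l leq_exp2l // le4 orbT.
Qed.

(** An untouched input tape, read through [track], holds this number in register [j], so no phase
    that converts the input is needed. *)
Definition track_num (Sigma : finType) (idx : Sigma -> nat) (w : seq Sigma)
  (j : nat) : nat :=
  foldr (fun a acc => (idx a == j) + acc.*2) 0 w.

Lemma in_PSPACE_of_prog (Sigma : finType) (idx : Sigma -> nat)
    (L : seq Sigma -> Prop) (p : prog) (b c : nat) :
  (forall w, exists2 s,
     run (2 ^ (size w + 2) ^ c.+1) p (track_num idx w) s & (0 < s b <-> L w)) ->
  in_PSPACE L.
Proof.
move=> H; have [r0 Hr0] := regs_belowE p.
pose r := maxn r0 b.+1.
have br : b < r by rewrite /r leq_max ltnSn orbT.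
have Hr : regs_below r p.
  by apply: regs_below_mono Hr0; rewrite /r leq_maxl.
pose pr := compile 0 p.
(* With [b] zero the last test jumps to the rejecting address; otherwise control falls through to
   the accepting one. *)
pose code := pr ++ [:: IJz b (size pr).+2].
have szc : size code = (size pr).+1 by rewrite /code size_cat addn1.
pose M := counter_tm idx r code.
have main w : exists n pc, [/\
    cfg_state (tm_run M w n) = pc_state code false pc,
    (pc = size code /\ L w) \/ (pc = (size code).+1 /\ ~ L w) &
    forall k, k <= n ->
      (Z.abs (cfg_head (tm_run M w k)) <= Z.of_nat ((size w + 2) ^ c.+2))%Z].
  have [s Hrun HL] := H w.
  set E := (size w + 2) ^ c.+1 in Hrun.
  (* One more factor, which is at least 2, puts [D] strictly above both the input length and [E]. *)
  set D := (size w + 2) ^ c.+2.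
  have [sD ED] : size w < D /\ E < D.
    have E1 : size w + 2 <= E by rewrite /E expnS leq_pmulr // expn_gt0 addn2.
    have -> : D = (size w + 2) * E by rewrite /D expnS.
    by split; nia.
  have [c1 c2] : code_at code 0 pr /\ code_at code (size pr) [:: IJz b (size pr).+2].
    by apply/(@code_at_cat code 0); split.
  have rp0 : rep idx (r := r) [seq inl a | a <- w] (track_num idx w).
    move=> j _; elim: w {H Hrun HL E D sD ED} => //= a w ->; congr (_ + _).
  have sD0 : size [seq (inl a : Sigma + {ffun 'I_r -> bool}) | a <- w] < D by rewrite size_map.
  have [cs' [rp1 sD1 re1]] := run_reach (idx := idx) Hrun ED c1 Hr rp0 sD0.
  have tN : (size pr).+2 < (size code).+2 by rewrite szc.
  have re2 := reach_jz idx (pre := [::]) (code_at1 c2) tN sD1.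
  have [n [en bn]] := reach_trans re1 re2.
  have e0 : tm_init M w = mkcfg idx code false 0 [seq inl a | a <- w] 0.
    rewrite /tm_init /mkcfg /tape; congr (_, _, _).
    by apply: functional_extensionality => z; rewrite -map_comp.
  exists n; exists (if tval idx b cs' == 0 then (size pr).+2 else (size pr).+1).
  split=> [||k' kn].
  - by rewrite /tm_run e0 en.
  - rewrite szc rp1 //; case: eqP => e; [right|left]; split=> //.
      by move/HL; rewrite e.
    by apply/HL; lia.
  - by rewrite /tm_run e0; apply: bn.
have halts w n pc : cfg_state (tm_run M w n) = pc_state code false pc ->
    pc = size code \/ pc = (size code).+1 -> tm_halted (cfg_state (tm_run M w n)).
  move=> -> pcE; rewrite /tm_halted /=.
  by case: pcE => ->; rewrite eqxx ?orbT.
have later w n m : tm_halted (cfg_state (tm_run M w n)) -> n <= m ->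
    tm_run M w m = tm_run M w n.
  by move=> Hh nm; rewrite /tm_run -(subnK nm) iterD halted_iter.
have acc_rej : pc_state code false (size code) != pc_state code false (size code).+1.
  by apply: state_neq => //; rewrite /= neq_ltn ltnSn.
exists M, (4 ^ c.+2); split=> [w|w k'].
- have [n [pc [en pcE bn]]] := main w.
  have Hn : tm_halted (cfg_state (tm_run M w n)).
    by apply: halts en _; case: pcE => [[-> _]|[-> _]]; [left|right].
  split; first by exists n.
  split=> [Lw|[m em]].
    by exists n; rewrite en; case: pcE => [[-> _]|[_ []]].
  case: pcE => [[]//|[pcN _]].
  have Hm : tm_halted (cfg_state (tm_run M w m)) by rewrite em /tm_halted eqxx.
  have : cfg_state (tm_run M w n) = cfg_state (tm_run M w m).
    case/orP: (leq_total n m) => le; first by rewrite (later _ _ _ Hn le).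
    by rewrite (later _ _ _ Hm le).
  by rewrite en em pcN => /eqP; rewrite eq_sym (negbTE acc_rej).
- have [n [pc [en pcE bn]]] := main w.
  have Hn : tm_halted (cfg_state (tm_run M w n)).
    by apply: halts en _; case: pcE => [[-> _]|[-> _]]; [left|right].
  apply: Z.le_trans (_ : (_ <= Z.of_nat ((size w + 2) ^ c.+2))%Z) _; last first.
    by apply/inj_le/leP; apply: expn_poly.
  case/orP: (leq_total k' n) => le; first exact: bn.
  by rewrite (later _ _ _ Hn le); apply: bn.
Qed.

(** * Functions computed with registers below 2^poly *)

Lemma run_mono B B' p s s' : B <= B' -> run B p s s' -> run B' p s s'.
Proof.
move=> le; elim=> {p s s'}.
- by move=> i s lt; apply: RunInc; apply: leq_trans le.
- by move=> i s lt; apply: RunDec.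
- by move=> p q s1 s2 s3 _ IH1 _ IH2; apply: RunSeq IH1 IH2.
- by move=> i p s e; apply: RunWhile0.
- by move=> i p s1 s2 s3 e _ IH1 _ IH2; apply: RunWhileS IH1 IH2.
Qed.

Lemma run_lt B p s s' : run B p s s' -> (forall j, s j < B) -> forall j, s' j < B.
Proof.
elim=> {p s s'}.
- by move=> i s lt H j; rewrite /upd; case: eqP.
- by move=> i s lt H j; rewrite /upd; case: eqP => // _; apply: leq_ltn_trans (leq_pred _) (H i).
- by move=> p q s1 s2 s3 _ IH1 _ IH2 /IH1/IH2.
- by [].
- by move=> i p s1 s2 s3 e _ IH1 _ IH2 /IH1/IH2.
Qed.

Ltac upd_ext := apply: functional_extensionality => ?; rewrite /upd /=;
  repeat (case: eqP => [?|?]); subst; try lia.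

Lemma upd_self s i : upd s i (s i) = s.
Proof. by upd_ext. Qed.

Lemma upd_eq s i v : upd s i v i = v.
Proof. by rewrite /upd eqxx. Qed.

Lemma upd_upd s i v w : upd (upd s i v) i w = upd s i w.
Proof. by upd_ext. Qed.

Definition PClear i := PWhile i (PDec i).
Definition PMove i j := PWhile i (PSeq (PDec i) (PInc j)).
(** Counting a register down destroys it, so two copies are made at once and the second is moved
    back to restore [i]. *)
Definition PCopy i b :=
  PSeq (PWhile i (PSeq (PDec i) (PSeq (PInc b) (PInc b.+1)))) (PMove b.+1 i).

Lemma run_clear B i s : run B (PClear i) s (upd s i 0).
Proof.
elim: {s}(s i) {-2}s (erefl (s i)) => [|n IH] s e.
  by rewrite -e upd_self; apply: RunWhile0.
apply: (@RunWhileS _ _ _ _ (upd s i n)); first by rewrite e.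
  by rewrite -[n]/(n.+1.-1) -e; apply: RunDec; rewrite e.
have -> : upd s i 0 = upd (upd s i n) i 0 by upd_ext.
by apply: IH; rewrite /upd eqxx.
Qed.

Lemma run_move B i j s : i != j -> s j + s i < B ->
  run B (PMove i j) s (upd (upd s j (s j + s i)) i 0).
Proof.
move=> ij; elim: {s}(s i) {-2}s (erefl (s i)) => [|n IH] s e; rewrite e => lt.
  rewrite addn0 upd_self -e upd_self; exact: RunWhile0.
pose s1 := upd s i n; pose s2 := upd s1 j (s j).+1.
apply: (@RunWhileS _ _ _ _ s2); first by rewrite e.
  apply: (@RunSeq _ _ _ _ s1).
    by rewrite /s1 -[n]/(n.+1.-1) -e; apply: RunDec; rewrite e.
  have ej : s1 j = s j by rewrite /s1 /upd eq_sym (negbTE ij).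
  by rewrite /s2 -ej; apply: RunInc; rewrite ej; lia.
have ei : s2 i = n by rewrite /s2 /s1 /upd (negbTE ij) eqxx.
have ej : s2 j = (s j).+1 by rewrite /s2 /upd eqxx.
have := IH s2 ei; rewrite ei ej addSnnS => /(_ lt).
by congr run; rewrite {ei ej}/s2 /s1; upd_ext.
Qed.

Lemma run_copy B i b s : i < b -> s b = 0 -> s b.+1 = 0 -> s i < B ->
  run B (PCopy i b) s (upd s b (s i)).
Proof.
move=> ib b0 b1 lt.
have H : forall n s', s' i = n -> s' b + n < B -> s' b.+1 + n < B ->
    run B (PWhile i (PSeq (PDec i) (PSeq (PInc b) (PInc b.+1)))) s'
      (upd (upd (upd s' b (s' b + n)) b.+1 (s' b.+1 + n)) i 0).
  elim=> [|n IH] s' e lb lb1.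
    rewrite !addn0 !upd_self -e upd_self; exact: RunWhile0.
  pose s1 := upd s' i n; pose s2 := upd s1 b (s' b).+1.
  pose s3 := upd s2 b.+1 (s' b.+1).+1.
  apply: (@RunWhileS _ _ _ _ s3); first by rewrite e.
    apply: (@RunSeq _ _ _ _ s1).
      by rewrite /s1 -[n]/(n.+1.-1) -e; apply: RunDec; rewrite e.
    apply: (@RunSeq _ _ _ _ s2).
      have eb : s1 b = s' b by rewrite /s1 /upd; case: eqP => //; lia.
      by rewrite /s2 -eb; apply: RunInc; rewrite eb; lia.
    have eb : s2 b.+1 = s' b.+1.
      by rewrite /s2 /s1 /upd; case: eqP; [lia|]; case: eqP => //; lia.
    by rewrite /s3 -eb; apply: RunInc; rewrite eb; lia.
  have ei : s3 i = n.
    by rewrite /s3 /s2 /s1 /upd eqxx; case: eqP; [lia|]; case: eqP => //; lia.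
  have eb : s3 b = (s' b).+1.
    by rewrite /s3 /s2 /s1 /upd eqxx; case: eqP => //; lia.
  have eb1 : s3 b.+1 = (s' b.+1).+1 by rewrite /s3 /upd eqxx.
  have := IH s3 ei; rewrite eb eb1 !addSnnS => /(_ lb lb1).
  by congr run; rewrite {ei eb eb1}/s3 /s2 /s1; upd_ext.
apply: RunSeq (H _ s erefl _ _) _; rewrite ?b0 ?b1 //.
set s1 := upd _ i 0.
have bi : b.+1 != i by lia.
have ei : s1 i = 0 by rewrite /s1 /upd eqxx.
have eb1 : s1 b.+1 = s i.
  by rewrite /s1 /upd; case: eqP; [lia|]; rewrite eqxx.
have := @run_move B b.+1 i s1 bi; rewrite ei eb1 => /(_ lt).
by congr run; rewrite /s1; upd_ext.
Qed.

(** * Functions of tuples and the growth of bit lengths *)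

Fixpoint E (k : nat) : Type := if k is k'.+1 then (E k' * nat)%type else unit.

Fixpoint Emap (s : nat -> nat) k : E k -> E k :=
  match k with
  | 0 => fun g => g
  | k'.+1 => fun g => (Emap s g.1, s g.2)
  end.

Fixpoint Eall (P : pred nat) k : E k -> bool :=
  match k with
  | 0 => fun _ => true
  | k'.+1 => fun g => Eall P g.1 && P g.2
  end.

Lemma Emap_ext s s' k (g : E k) (P : pred nat) :
  (forall i, P i -> s i = s' i) -> Eall P g -> Emap s g = Emap s' g.
Proof.
move=> H; elim: k g => //= k IH g /andP[/IH-> Pg].
by rewrite (H _ Pg).
Qed.

Lemma Eall_sub (P Q : pred nat) k (g : E k) : subpred P Q -> Eall P g -> Eall Q g.
Proof. by move=> PQ; elim: k g => //= k IH g /andP[/IH-> /PQ->]. Qed.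

Lemma Eall_map s (P : pred nat) k (g : E k) :
  Eall (fun i => P (s i)) g = Eall P (Emap s g).
Proof. by elim: k g => //= k IH g; rewrite IH. Qed.

(** Powers of [m + 2] stand for all polynomials: the base is at least 2 even for [m = 0], so a
    larger exponent absorbs constants, sums and products. *)
Definition bnd (m c : nat) := 2 ^ (m + 2) ^ c.+1.

Lemma bnd_mono m m' c c' : m <= m' -> c <= c' -> bnd m c <= bnd m' c'.
Proof.
move=> mm cc; rewrite /bnd leq_exp2l // (@leq_trans ((m' + 2) ^ c.+1)) //.
  by rewrite leq_exp2r // leq_add2r.
by rewrite leq_exp2l //; lia.
Qed.

Lemma expn_le_bnd m c : 2 ^ m <= bnd m c.
Proof.
rewrite /bnd leq_exp2l // expnS (@leq_trans (m + 2)) ?leq_addr //.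
by rewrite leq_pmulr // expn_gt0 addn2.
Qed.

(** Values below [bnd m c] have bit length [(m + 2) ^ c.+1], which is the [m] seen by a program
    started on them. Adding 2 to that length costs at most one more factor [m + 2]. *)
Lemma bnd_comp m c c' : bnd ((m + 2) ^ c.+1) c' <= bnd m (c.+2 * c'.+1).
Proof.
rewrite /bnd leq_exp2l //.
apply: (@leq_trans (((m + 2) ^ c.+2) ^ c'.+1)).
  rewrite leq_exp2r // [X in _ <= X]expnS.
  have : m + 2 <= (m + 2) ^ c.+1 by rewrite expnS leq_pmulr // expn_gt0 addn2.
  by nia.
by rewrite -expnM leq_exp2l //; lia.
Qed.

(* [PS f]: compiled register programs compute [f] from arguments held in any
   registers [rho] below [b], leaving the result in register [b] and every other
   register unchanged, with all values bounded by 2^poly of the bit length [m]. *)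
Definition PS k (f : E k -> nat) : Prop :=
  forall (rho : E k) b, Eall (fun i => i < b) rho ->
  exists p c, forall s m, (forall j, b <= j -> s j = 0) ->
    (forall j, s j < 2 ^ m) ->
    run (bnd m c) p s (upd s b (f (Emap s rho))).

Definition pbounded k (f : E k -> nat) : Prop :=
  exists c, forall m g, Eall (fun x => x < 2 ^ m) g -> f g < bnd m c.

Lemma PS_ext k (f g : E k -> nat) : f =1 g -> PS f -> PS g.
Proof.
move=> fg H rho b rb; have [p [c Hp]] := H rho b rb.
by exists p, c => s m s0 sm; rewrite -fg; apply: Hp.
Qed.

Fixpoint Eiota k : E k := if k is k'.+1 then (Eiota k', k') else tt.

Fixpoint Eget k (g : E k) (i : nat) : nat :=
  match k return E k -> nat with
  | 0 => fun _ => 0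
  | k'.+1 => fun g => if i == k' then g.2 else Eget g.1 i
  end g.

Lemma Eall_iota k b : k <= b -> Eall (fun i => i < b) (Eiota k).
Proof. by elim: k b => //= k IH b kb; rewrite IH //=; lia. Qed.

Lemma Eget_iota k (g : E k) : Emap (Eget g) (Eiota k) = g.
Proof.
elim: k g => [[]|k IH [g x]] //=; rewrite eqxx -[in RHS](IH g); congr (_, _).
apply: (@Emap_ext _ _ _ _ (fun i => i < k)) (Eall_iota (leqnn k)) => i ik.
by case: eqP => // e; lia.
Qed.

Lemma Eget_lt k (g : E k) M i : 0 < M -> Eall (fun x => x < M) g -> Eget g i < M.
Proof. by move=> M0; elim: k g => //= k IH [g x] /= /andP[/IH H xM]; case: eqP. Qed.

Lemma Eget_ge k (g : E k) i : k <= i -> Eget g i = 0.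
Proof. by elim: k g => //= k IH g ki; case: eqP => [|_]; [lia | apply: IH; lia]. Qed.

(** The guard on increments bounds every register of a run, in particular the one that holds the
    result. *)
Lemma PS_pbounded k (f : E k -> nat) : PS f -> pbounded f.
Proof.
move=> /(_ (Eiota k) k (Eall_iota (leqnn k)))[p [c H]]; exists c => m g gm.
have lt j : Eget g j < 2 ^ m by rewrite Eget_lt ?expn_gt0.
have := run_lt (H (Eget g) m (@Eget_ge k g) lt).
move=> /(_ (fun j => leq_trans (lt j) (expn_le_bnd m c)) k).
by rewrite /upd eqxx Eget_iota.
Qed.

Lemma PS_const k n : PS (fun _ : E k => n).
Proof.
move=> rho b rb.
exists (iter n (fun p => PSeq p (PInc b)) (PClear b)), n => s m s0 sm.
have : forall i, i <= n -> run (bnd m n) (iter i (fun p => PSeq p (PInc b)) (PClear b)) s (upd s b i).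
  elim=> [|i IH] le /=; first exact: run_clear.
  apply: RunSeq (IH (ltnW le)) _.
  have -> : upd s b i.+1 = upd (upd s b i) b (upd s b i b).+1.
    by rewrite upd_eq upd_upd.
  apply: RunInc; rewrite upd_eq (leq_ltn_trans le) // /bnd.
  rewrite (leq_trans (ltn_expl n (isT : 1 < 2))) // leq_exp2l // addn2.
  rewrite (leq_trans (ltnW (ltn_expl n (isT : 1 < 2)))) //.
  by rewrite (@leq_trans (2 ^ n.+1)) ?leq_exp2l ?leq_exp2r.
exact.
Qed.

Lemma PS_var k : PS (fun g : E k.+1 => g.2).
Proof.
move=> rho b /= /andP[_ rb]; exists (PCopy rho.2 b), 0 => s m s0 sm.
apply: run_copy; [exact: rb | exact: s0 | by apply: s0 | ].
by rewrite (leq_trans (sm _)) ?expn_le_bnd.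
Qed.

Lemma PS_weaken k (f : E k -> nat) : PS f -> PS (fun g : E k.+1 => f g.1).
Proof. by move=> H rho b /= /andP[rb _]; apply: H. Qed.

Lemma PS_succ k (f : E k -> nat) : PS f -> PS (fun g => (f g).+1).
Proof.
move=> H rho b rb; have [p [c Hp]] := H rho b rb.
exists (PSeq p (PInc b)), c.+1 => s m s0 sm.
have Hr := Hp s m s0 sm.
apply: RunSeq (run_mono _ Hr) _; first exact: bnd_mono.
set s1 := upd s b _.
have -> : upd s b (f (Emap s rho)).+1 = upd s1 b (s1 b).+1.
  by rewrite /s1 upd_eq upd_upd.
apply: RunInc.
have lt : s1 b < bnd m c.
  by apply: (run_lt Hr) => j; rewrite (leq_trans (sm _)) ?expn_le_bnd.
apply: leq_ltn_trans lt _; rewrite /bnd ltn_exp2l // ltn_exp2l //; lia.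
Qed.

Lemma run_clear_move B b s v w : s b.+1 = 0 -> w < B ->
  run B (PSeq (PClear b) (PMove b.+1 b)) (upd (upd s b v) b.+1 w) (upd s b w).
Proof.
move=> e lt; apply: RunSeq (run_clear _ _ _) _.
set s1 := upd _ b 0.
have n : b.+1 != b by lia.
have e1 : s1 b = 0 by rewrite /s1 /upd eqxx.
have e2 : s1 b.+1 = w by rewrite /s1 /upd eqxx; case: eqP => //; lia.
have := @run_move B b.+1 b s1 n; rewrite e1 e2 => /(_ lt).
by congr run; rewrite {e1 e2}/s1; upd_ext.
Qed.

(** The argument stays in register [b] while [h] uses scratch registers from [b.+1] on, so it is
    computed once and may then be read as a variable. *)
Lemma PS_let k (a : E k -> nat) (h : E k -> nat -> nat) :
  PS a -> PS (fun g : E k.+1 => h g.1 g.2) -> PS (fun g => h g (a g)).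
Proof.
move=> Ha Hh rho b rb.
have [p [c Hp]] := Ha rho b rb.
have rb' : @Eall (fun i => i < b.+1) k.+1 (rho, b).
  rewrite /= ltnSn andbT; apply: Eall_sub rb => i; exact: ltnW.
have [q [d Hq]] := Hh (rho, b) b.+1 rb'.
pose C := maxn c (c.+2 * d.+1).
exists (PSeq p (PSeq q (PSeq (PClear b) (PMove b.+1 b)))), C => s m s0 sm.
have Hr := Hp s m s0 sm.
have sB j : s j < bnd m c by rewrite (leq_trans (sm _)) ?expn_le_bnd.
have s1B := run_lt Hr sB.
apply: RunSeq (run_mono _ Hr) _; first by rewrite bnd_mono ?leq_maxl.
set f1 := a _ in Hr s1B *.
set s1 := upd s b f1 in Hr s1B *.
have s1z j : b.+1 <= j -> s1 j = 0.
  by move=> bj; rewrite /s1 /upd; case: eqP => [|_]; [lia | rewrite s0 //; lia].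
have Hr2 := Hq s1 _ s1z s1B.
have es : Emap s1 rho = Emap s rho.
  apply: (Emap_ext _ rb) => i ib; rewrite /s1 /upd; case: eqP => //; lia.
have s2B := run_lt Hr2 (fun j => leq_trans (s1B j) (expn_le_bnd _ _)).
have le : bnd ((m + 2) ^ c.+1) d <= bnd m C.
  by apply: leq_trans (bnd_comp _ _ _) _; rewrite bnd_mono ?leq_maxr.
apply: RunSeq (run_mono le Hr2) _.
have e1 : s1 b = f1 by rewrite /s1 upd_eq.
rewrite /= es e1 in s2B *.
apply: run_clear_move; first by apply: s0; lia.
by have := s2B b.+1; rewrite /upd eqxx => /leq_trans; apply.
Qed.

Fixpoint nrec (z : nat) (h : nat -> nat -> nat) (n : nat) : nat :=
  if n is n'.+1 then h n' (nrec z h n') else z.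

Lemma run_replace B i j s : i != j -> s j < B ->
  run B (PSeq (PClear i) (PMove j i)) s (upd (upd s i (s j)) j 0).
Proof.
move=> ij lt; apply: RunSeq (run_clear _ _ _) _.
set s1 := upd _ i 0.
have e1 : s1 i = 0 by rewrite /s1 upd_eq.
have e2 : s1 j = s j by rewrite /s1 /upd eq_sym (negbTE ij).
rewrite eq_sym in ij.
have := @run_move B j i s1 ij; rewrite e1 e2 => /(_ lt).
by congr run; rewrite {e1 e2}/s1; upd_ext.
Qed.

(** Without a bound on all intermediate values the rounds would compose an unbounded number of
    polynomials; with it, every round starts below the same [bnd m c]. Register [b] counts down,
    [b.+1] holds the accumulator, [b.+2] the index, and [b.+3] receives the next value. *)
Lemma PS_rec k (n z : E k -> nat) (h : E k -> nat -> nat -> nat) :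
  PS n -> PS z -> PS (fun g : E k.+2 => h g.1.1 g.1.2 g.2) ->
  (exists c, forall m g, Eall (fun x => x < 2 ^ m) g ->
     forall i, i <= n g -> nrec (z g) (h g) i < bnd m c) ->
  PS (fun g => nrec (z g) (h g) (n g)).
Proof.
move=> Hn Hz Hh [c3 Hb] rho b rb.
have rb1 : Eall (fun i => i < b.+1) rho by apply: Eall_sub rb => i; exact: ltnW.
have rb3 : @Eall (fun i => i < b.+3) k.+2 ((rho, b.+2), b.+1).
  rewrite /= ltnSn [b.+1 < _]ltnW // !andbT.
  by apply: Eall_sub rb => i ib; rewrite !ltnS !leqW // ltnW.
have [p1 [c1 H1]] := Hn rho b rb.
have [p2 [c2 H2]] := Hz rho b.+1 rb1.
have [p3 [d H3]] := Hh ((rho, b.+2), b.+1) b.+3 rb3.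
pose q := PSeq (PDec b) (PSeq p3 (PSeq (PSeq (PClear b.+1) (PMove b.+3 b.+1)) (PInc b.+2))).
pose c := maxn c1 c3.
pose C := maxn (c.+2 * d.+1) (c.+2 * c2.+1).
exists (PSeq p1 (PSeq p2 (PSeq (PWhile b q)
   (PSeq (PClear b.+2) (PSeq (PClear b) (PMove b.+1 b)))))), C => s m s0 sm.
set g := Emap s rho.
have gm : Eall (fun x => x < 2 ^ m) g.
  by rewrite -Eall_map; elim: (k) (rho) => //= k' IH r; rewrite IH sm.
pose N := n g.
pose acc i := nrec (z g) (h g) i.
have lec1 : bnd m c1 <= bnd m c by rewrite bnd_mono ?leq_maxl.
have lec3 : bnd m c3 <= bnd m c by rewrite bnd_mono ?leq_maxr.
have lecC : bnd m c <= bnd m C by rewrite bnd_mono // /C; nia.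
have sB j : s j < bnd m c by rewrite (leq_trans (sm _)) ?expn_le_bnd.
have Hr1 := H1 s m s0 sm; rewrite -/g -/N in Hr1.
have NB : N < bnd m c.
  apply: leq_trans lec1; have := run_lt Hr1 _ b; rewrite upd_eq; apply => j.
  by rewrite (leq_trans (sm _)) ?expn_le_bnd.
have accB i : i <= N -> acc i < bnd m c by move=> iN; apply: leq_trans lec3; apply: Hb.
pose m1 := (m + 2) ^ c.+1.
pose st i := upd (upd (upd s b (N - i)) b.+1 (acc i)) b.+2 i.
have Eg s' : (forall i, i < b -> s' i = s i) -> Emap s' rho = g.
  by move=> e; apply: (Emap_ext _ rb).
have h2 : run (bnd m C) p2 (upd s b N) (st 0).
  have := H2 (upd s b N) m1.
  rewrite Eg => [|i ib]; last by rewrite /upd; case: eqP => //; lia.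
  have -> : upd (upd s b N) b.+1 (z g) = st 0.
    have e2 : s b.+2 = 0 by apply: s0; lia.
    by rewrite /st /acc /= subn0; upd_ext.
  move=> H; apply: run_mono (H _ _).
  - by apply: leq_trans (bnd_comp _ _ _) _; rewrite bnd_mono ?leq_maxr.
  - by move=> j bj; rewrite /upd; case: eqP => [|_]; [lia | apply: s0; lia].
  - by move=> j; rewrite /upd; case: eqP => _; [exact: NB | exact: sB].
have hq i : i < N -> run (bnd m C) q (st i) (st i.+1).
  move=> iN.
  have stB s' : s' = upd (st i) b (N - i).-1 -> forall j, s' j < bnd m c.
    move=> -> j; rewrite /st /upd; repeat case: eqP => _ //; try lia.
    by apply: accB; lia.
  pose s1 := upd (st i) b (N - i).-1.
  pose s2 := upd s1 b.+3 (acc i.+1).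
  pose s3 := upd (upd s2 b.+1 (s2 b.+3)) b.+3 0.
  have s1b1 : s1 b.+1 = acc i.
    by rewrite /s1 /st /upd; repeat (case: eqP; try lia).
  have s1b2 : s1 b.+2 = i.
    by rewrite /s1 /st /upd; repeat (case: eqP; try lia).
  have stb : st i b = N - i.
    by rewrite /st /upd; repeat (case: eqP; try lia).
  have s0b3 : s b.+3 = 0 by apply: s0; lia.
  apply: (@RunSeq _ _ _ _ s1).
    by rewrite /s1 -stb; apply: RunDec; rewrite stb; lia.
  apply: (@RunSeq _ _ _ _ s2).
    have := H3 s1 m1; rewrite /= s1b1 s1b2 Eg => [|j jb]; last first.
      by rewrite /s1 /st /upd; repeat (case: eqP; try lia).
    move=> H; apply: run_mono (H _ (stB _ erefl)).
      by apply: leq_trans (bnd_comp _ _ _) _; rewrite bnd_mono ?leq_maxl.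
    move=> j bj; rewrite /s1 /st /upd; repeat (case: eqP; try lia).
    by move=> *; apply: s0; lia.
  have s2b3 : s2 b.+3 = acc i.+1 by rewrite /s2 upd_eq.
  apply: (@RunSeq _ _ _ _ s3).
    apply: run_replace; first by lia.
    by rewrite s2b3; apply: leq_trans lecC; apply: accB.
  have s3b2 : s3 b.+2 = i.
    by rewrite /s3 /s2 /upd; repeat (case: eqP; try lia).
  have -> : st i.+1 = upd s3 b.+2 (s3 b.+2).+1.
    rewrite s3b2; unfold s3; rewrite s2b3; unfold s2, s1, st; clear s3b2 s3 s2b3 s2 s1b1 s1b2 s1 stb stB.
    apply: functional_extensionality => j.
    by rewrite /upd; repeat (case: eqP => ?); subst; lia.
  by apply: RunInc; rewrite s3b2; apply: leq_ltn_trans iN (leq_trans NB lecC).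
have hw i : i <= N -> run (bnd m C) (PWhile b q) (st (N - i)) (st N).
  elim: i => [|i IH] iN.
    rewrite subn0; apply: RunWhile0.
    by rewrite /st /upd; repeat (case: eqP; try lia).
  apply: RunWhileS (hq (N - i.+1) _) _.
  - by rewrite /st /upd; repeat (case: eqP; try lia).
  - by lia.
  - have -> : (N - i.+1).+1 = N - i by lia.
    by apply: IH; lia.
apply: RunSeq (run_mono _ Hr1) _; first exact: leq_trans lec1 lecC.
apply: RunSeq h2 _.
have := hw N (leqnn N); rewrite subnn => hw0.
apply: RunSeq hw0 _.
apply: RunSeq (run_clear _ _ _) _.
have -> : upd (st N) b.+2 0 = upd (upd s b 0) b.+1 (acc N).
  have e2 : s b.+2 = 0 by apply: s0; lia.
  by rewrite /st subnn; upd_ext.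
apply: run_clear_move; first by apply: s0.
by apply: leq_trans lecC; apply: accB.
Qed.

(** * Arithmetic and bounded quantification *)

Lemma track_num_lt (Sigma : finType) (idx : Sigma -> nat) w j :
  track_num idx w j < 2 ^ size w.
Proof. by elim: w => //= a w IH; rewrite expnS; case: eqP; lia. Qed.

Theorem in_PSPACE_of_PS (Sigma : finType) (idx : Sigma -> nat) (k : nat)
    (L : seq Sigma -> Prop) (f : E k -> nat) :
  (forall a, idx a < k) -> PS f ->
  (forall w, 0 < f (Emap (track_num idx w) (Eiota k)) <-> L w) ->
  in_PSPACE L.
Proof.
move=> idxk /(_ (Eiota k) k (Eall_iota (leqnn k)))[p [c H]] HL.
apply: (@in_PSPACE_of_prog _ idx L p k c) => w.
have z j : k <= j -> track_num idx w j = 0.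
  move=> kj; elim: w => //= a w ->; rewrite addn0.
  by case: eqP => // e; have := idxk a; lia.
by eexists; [exact: (H _ _ z (track_num_lt idx w)) | rewrite upd_eq].
Qed.

Lemma bnd_sq m c : bnd m c * bnd m c <= bnd m c.+1.
Proof. by rewrite /bnd -expnD leq_exp2l // addnn -mul2n [X in _ <= X]expnS leq_mul2r addn2 orbT. Qed.

Lemma bnd_ge2 m c : 1 < bnd m c.
Proof. by rewrite /bnd -[1]/(2 ^ 0) ltn_exp2l // expn_gt0 addn2. Qed.

Lemma pbounded_mul k (a b : E k -> nat) :
  pbounded a -> pbounded b -> pbounded (fun g => a g * b g).
Proof.
move=> [c H] [d H']; exists (maxn c d).+1 => m g gm.
apply: leq_trans (bnd_sq _ _); apply: ltn_mul.
  by apply: leq_trans (H _ _ gm) _; rewrite bnd_mono ?leq_maxl.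
by apply: leq_trans (H' _ _ gm) _; rewrite bnd_mono ?leq_maxr.
Qed.

Lemma pbounded_add k (a b : E k -> nat) :
  pbounded a -> pbounded b -> pbounded (fun g => a g + b g).
Proof.
move=> [c H] [d H']; exists (maxn c d).+1 => m g gm.
have := leq_trans (H _ _ gm) (bnd_mono (leqnn m) (leq_maxl c d)).
have := leq_trans (H' _ _ gm) (bnd_mono (leqnn m) (leq_maxr c d)).
have := bnd_sq m (maxn c d); have := bnd_ge2 m (maxn c d); nia.
Qed.

Lemma PS_rec_bounded k (n z B : E k -> nat) (h : E k -> nat -> nat -> nat) :
  PS n -> PS z -> PS (fun g : E k.+2 => h g.1.1 g.1.2 g.2) -> pbounded B ->
  (forall g i, i <= n g -> nrec (z g) (h g) i <= B g) ->
  PS (fun g => nrec (z g) (h g) (n g)).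
Proof.
move=> Hn Hz Hh [c HB] le; apply: PS_rec => //; exists c => m g gm i iN.
by apply: leq_ltn_trans (le _ _ iN) (HB _ _ gm).
Qed.

Definition PB k (P : E k -> bool) : Prop := PS (fun g => nat_of_bool (P g)).

(** A conditional is a recursion with zero or one round. *)
Lemma PS_if k (c : E k -> bool) (a b : E k -> nat) :
  PB c -> PS a -> PS b -> PS (fun g => if c g then a g else b g).
Proof.
move=> Hc Ha Hb.
apply: (@PS_ext _ (fun g => nrec (b g) (fun _ _ => a g) (c g))).
  by move=> g; case: (c g).
apply: (PS_rec_bounded (B := fun g => b g + a g) Hc Hb (PS_weaken (PS_weaken Ha))).
  by apply: pbounded_add; apply: PS_pbounded.
by move=> g [|i] _ /=; rewrite ?leq_addr ?leq_addl.
Qed.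

Lemma PS_add k (a b : E k -> nat) : PS a -> PS b -> PS (fun g => a g + b g).
Proof.
move=> Ha Hb.
have e g i : nrec (a g) (fun _ acc => acc.+1) i = a g + i.
  by elim: i => [|i /= ->]; rewrite ?addn0 ?addnS.
apply: (@PS_ext _ (fun g => nrec (a g) (fun _ acc => acc.+1) (b g))) => [g|]; first exact: e.
apply: (PS_rec_bounded (B := fun g => a g + b g) Hb Ha (PS_succ (@PS_var _))).
  by apply: pbounded_add; apply: PS_pbounded.
by move=> g i ib; rewrite e leq_add2l.
Qed.

Lemma PS_mul k (a b : E k -> nat) : PS a -> PS b -> PS (fun g => a g * b g).
Proof.
move=> Ha Hb.
have e g i : nrec 0 (fun _ acc => acc + a g) i = a g * i.
  by elim: i => [|i /= ->]; rewrite ?muln0 ?mulnS 1?addnC.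
apply: (@PS_ext _ (fun g => nrec 0 (fun _ acc => acc + a g) (b g))) => [g|]; first exact: e.
apply: (PS_rec_bounded (B := fun g => a g * b g) Hb (@PS_const _ 0)
  (PS_add (@PS_var _) (PS_weaken (PS_weaken Ha)))).
  by apply: pbounded_mul; apply: PS_pbounded.
by move=> g i ib; rewrite e leq_mul2l ib orbT.
Qed.

Lemma PS_pred k (a : E k -> nat) : PS a -> PS (fun g => (a g).-1).
Proof.
move=> Ha.
have e i : nrec 0 (fun i _ => i) i = i.-1 by case: i.
apply: (@PS_ext _ (fun g => nrec 0 (fun i _ => i) (a g))) => [g|]; first exact: e.
apply: (PS_rec_bounded (B := a) Ha (@PS_const _ 0) (PS_weaken (@PS_var _))).
  exact: PS_pbounded.
by move=> g i ib; rewrite e; lia.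
Qed.

Lemma PS_sub k (a b : E k -> nat) : PS a -> PS b -> PS (fun g => a g - b g).
Proof.
move=> Ha Hb.
have e g i : nrec (a g) (fun _ acc => acc.-1) i = a g - i.
  by elim: i => [|i IH] /=; rewrite ?IH; lia.
apply: (@PS_ext _ (fun g => nrec (a g) (fun _ acc => acc.-1) (b g))) => [g|]; first exact: e.
apply: (PS_rec_bounded (B := a) Hb Ha (PS_pred (@PS_var _))); first exact: PS_pbounded.
by move=> g i ib; rewrite e leq_subr.
Qed.

Lemma PB_const k b : PB (fun _ : E k => b).
Proof. exact: PS_const. Qed.

Lemma PB_leq k (a b : E k -> nat) : PS a -> PS b -> PB (fun g => a g <= b g).
Proof.
move=> Ha Hb; rewrite /PB.
apply: (@PS_ext _ (fun g => nrec 1 (fun _ _ => 0) (a g - b g))).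
  by move=> g; rewrite /leq; case: (a g - b g).
apply: (PS_rec_bounded (B := fun=> 1) (PS_sub Ha Hb) (@PS_const _ 1) (@PS_const _ 0)).
  exact: PS_pbounded (@PS_const _ 1).
by move=> g [|i].
Qed.

Lemma PB_and k (a b : E k -> bool) : PB a -> PB b -> PB (fun g => a g && b g).
Proof.
move=> Ha Hb; rewrite /PB.
apply: PS_ext (PS_if Ha Hb (@PS_const _ 0)) => g; by case: (a g).
Qed.

Lemma PB_or k (a b : E k -> bool) : PB a -> PB b -> PB (fun g => a g || b g).
Proof.
move=> Ha Hb; rewrite /PB.
apply: PS_ext (PS_if Ha (@PS_const _ 1) Hb) => g; by case: (a g).
Qed.

Lemma PB_neg k (a : E k -> bool) : PB a -> PB (fun g => ~~ a g).
Proof.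
move=> Ha; rewrite /PB.
apply: PS_ext (PS_if Ha (@PS_const _ 0) (@PS_const _ 1)) => g; by case: (a g).
Qed.

Lemma PB_ext k (a b : E k -> bool) : a =1 b -> PB a -> PB b.
Proof. by move=> e; apply: PS_ext => g; rewrite e. Qed.

Lemma PB_imp k (a b : E k -> bool) : PB a -> PB b -> PB (fun g => a g ==> b g).
Proof.
by move=> Ha Hb; apply: PB_ext (PB_or (PB_neg Ha) Hb) => g; case: (a g).
Qed.

Lemma PB_iff k (a b : E k -> bool) : PB a -> PB b -> PB (fun g => a g == b g).
Proof.
move=> Ha Hb; apply: PB_ext (PB_and (PB_imp Ha Hb) (PB_imp Hb Ha)) => g.
by case: (a g); case: (b g).
Qed.

Lemma PB_eqn k (a b : E k -> nat) : PS a -> PS b -> PB (fun g => a g == b g).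
Proof.
move=> Ha Hb; apply: PB_ext (PB_and (PB_leq Ha Hb) (PB_leq Hb Ha)) => g.
by rewrite eqn_leq.
Qed.

Fixpoint ball (n : nat) (P : pred nat) : bool :=
  if n is n'.+1 then ball n' P && P n' else true.
Fixpoint bex (n : nat) (P : pred nat) : bool :=
  if n is n'.+1 then bex n' P || P n' else false.
(* The largest witness, with junk value 0 when there is none. *)
Fixpoint bsome (n : nat) (P : pred nat) : nat :=
  if n is n'.+1 then if P n' then n' else bsome n' P else 0.

Lemma ballP n (P : pred nat) : reflect (forall i, i < n -> P i) (ball n P).
Proof.
apply: (iffP idP); elim: n => //= n IH.
  by move=> /andP[/IH H Pn] i; rewrite ltnS leq_eqVlt => /orP[/eqP->|/H].
by move=> H; rewrite IH ?H // => i lt; apply: H; apply: ltnW.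
Qed.

Lemma bexP n (P : pred nat) : reflect (exists2 i, i < n & P i) (bex n P).
Proof.
apply: (iffP idP); elim: n => [|n IH] //=; last first.
  move=> [i]; rewrite ltnS leq_eqVlt => /orP[/eqP->->|lt Pi]; rewrite ?orbT //.
  by rewrite IH //; exists i.
  by case.
  by move=> /orP[/IH[i lt Pi]|Pn]; [exists i => //; apply: ltnW | exists n].
Qed.

Lemma bsomeP n (P : pred nat) i : i < n -> P i -> bsome n P < n /\ P (bsome n P).
Proof.
elim: n => //= n IH; rewrite ltnS leq_eqVlt; case: ifP => [Pn _ _|Pn]; first by split.
by move=> /orP[/eqP->|lt Pi]; [rewrite Pn | have [/ltnW] := IH lt Pi].
Qed.

Lemma bsome_le n (P : pred nat) : bsome n P <= n.
Proof. by elim: n => //= n IH; case: ifP => _ //; apply: leqW. Qed.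

Lemma PB_ball k (n : E k -> nat) (P : E k -> nat -> bool) :
  PS n -> PB (fun g : E k.+1 => P g.1 g.2) -> PB (fun g => ball (n g) (P g)).
Proof.
move=> Hn HP; rewrite /PB.
have e g i : nrec 1 (fun i acc => if P g i then acc else 0) i = ball i (P g).
  by elim: i => //= i ->; case: (P g i); rewrite ?andbT ?andbF.
apply: (@PS_ext _ (fun g => nrec 1 (fun i acc => if P g i then acc else 0) (n g))) => [g|].
  exact: e.
apply: (PS_rec_bounded (B := fun=> 1) Hn (@PS_const _ 1)
  (PS_if (c := fun g : E k.+2 => P g.1.1 g.1.2) (PS_weaken HP) (@PS_var _) (@PS_const _ 0))).
  exact: PS_pbounded (@PS_const _ 1).
by move=> g i _; rewrite e leq_b1.
Qed.

Lemma PB_bex k (n : E k -> nat) (P : E k -> nat -> bool) :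
  PS n -> PB (fun g : E k.+1 => P g.1 g.2) -> PB (fun g => bex (n g) (P g)).
Proof.
move=> Hn HP; apply: PB_ext (PB_neg (PB_ball (P := fun g i => ~~ P g i) Hn (PB_neg HP))) => g.
by elim: (n g) => //= m <-; rewrite negb_and negbK.
Qed.

Lemma PS_bsome k (n : E k -> nat) (P : E k -> nat -> bool) :
  PS n -> PB (fun g : E k.+1 => P g.1 g.2) -> PS (fun g => bsome (n g) (P g)).
Proof.
move=> Hn HP.
have e g i : nrec 0 (fun i acc => if P g i then i else acc) i = bsome i (P g).
  by elim: i => //= i ->.
apply: (@PS_ext _ (fun g => nrec 0 (fun i acc => if P g i then i else acc) (n g))) => [g|].
  exact: e.
apply: (PS_rec_bounded (B := n) Hn (@PS_const _ 0)
  (PS_if (c := fun g : E k.+2 => P g.1.1 g.1.2) (PS_weaken HP) (PS_weaken (@PS_var _)) (@PS_var _))).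
  exact: PS_pbounded.
by move=> g i ni; rewrite e (leq_trans (bsome_le _ _)).
Qed.

Lemma bsome_max n (P : pred nat) i : i < n -> P i -> i <= bsome n P.
Proof.
elim: n => //= n IH; rewrite ltnS leq_eqVlt => lt Pi; case: ifP => Pn.
  by rewrite leq_eqVlt.
by apply: IH => //; case/orP: lt => // /eqP e; rewrite -e Pi in Pn.
Qed.

Lemma PS_half k (a : E k -> nat) : PS a -> PS (fun g => (a g)./2).
Proof.
move=> Ha.
apply: (@PS_ext _ (fun g => bsome (a g).+1 (fun q => q + q <= a g))) => [g|].
  have [lt le] := @bsomeP (a g).+1 (fun q => q + q <= a g) 0 isT isT.
  have := @bsome_max (a g).+1 (fun q => q + q <= a g) (a g)./2; lia.
apply: PS_bsome (PS_succ Ha) _.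
exact: PB_leq (PS_add (@PS_var _) (@PS_var _)) (PS_weaken Ha).
Qed.

Lemma PB_odd k (a : E k -> nat) : PS a -> PB (fun g => odd (a g)).
Proof.
move=> Ha; apply: PB_ext (PB_neg (PB_eqn Ha (PS_add (PS_half Ha) (PS_half Ha)))) => g.
by lia.
Qed.

Definition nbit (i x : nat) : bool := odd (x %/ 2 ^ i).

Lemma PB_bit k (i a : E k -> nat) : PS i -> PS a -> PB (fun g => nbit (i g) (a g)).
Proof.
move=> Hi Ha; apply: (@PB_odd _ (fun g => a g %/ 2 ^ i g)).
have e x j : nrec x (fun _ acc => acc./2) j = x %/ 2 ^ j.
  elim: j => [|j /= ->]; first by rewrite divn1.
  by rewrite -[_./2]divn2 -divnMA -expnSr.
apply: PS_ext (PS_rec_bounded (B := a) Hi Ha (PS_half (@PS_var _)) (PS_pbounded Ha) _) => [g|g j _].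
  exact: e.
by rewrite e leq_div.
Qed.

Lemma PS_exp2_sq k (a y : E k -> nat) :
  PS a -> PS y -> (forall g, 2 ^ a g <= y g) -> PS (fun g => 2 ^ (a g * a g)).
Proof.
move=> Ha Hy le; have e i : nrec 1 (fun _ acc => acc + acc) i = 2 ^ i.
  by elim: i => //= i ->; rewrite expnS mul2n addnn.
apply: PS_ext (PS_rec_bounded (B := fun g => 2 ^ (a g * a g)) (PS_mul Ha Ha) (@PS_const _ 1)
  (PS_add (@PS_var _) (@PS_var _)) _ _) => [g||g i ni].
- exact: e.
- have [c H] := PS_pbounded Hy; exists (c.+1 + c) => m g /H.
  move=> /(leq_ltn_trans (le g)); rewrite /bnd !ltn_exp2l // => lt.
  by rewrite -addnS expnD; apply: ltn_mul.
- by rewrite e leq_exp2l.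
Qed.

Ltac ps_weaken :=
  lazymatch goal with
  | |- PS (k := S ?k) ?f =>
    let h := eval cbn beta iota delta [fst snd] in (fun g : E k => f (g, 0)) in
    change (PS (fun g : E (S k) => h g.1)); apply: (@PS_weaken k h)
  end.
Ltac ps_leaf := first [assumption | exact: PS_var | exact: PS_const | ps_weaken; ps_leaf].

Ltac ps := first
 [ assumption
 | lazymatch goal with
   | |- PB (fun g => (_ && _)) => apply: PB_and
   | |- PB (fun g => (_ || _)) => apply: PB_or
   | |- PB (fun g => (_ ==> _)) => apply: PB_imp
   | |- PB (fun g => true) => exact: PB_const
   | |- PB (fun g => false) => exact: PB_const
   | |- PB (fun g => ~~ _) => apply: PB_neg
   | |- PB (fun g => ball _ _) => apply: PB_ball
   | |- PB (fun g => bex _ _) => apply: PB_bex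
   | |- PB (fun g => nbit _ _) => apply: PB_bit
   | |- PB (fun g => (_ <= _)) => apply: PB_leq
   | |- PB (fun g => @eq_op Datatypes_bool__canonical__eqtype_Equality _ _) => apply: PB_iff
   | |- PB (fun g => _ == _) => apply: PB_eqn
   | |- PS (fun g => bsome _ _) => apply: PS_bsome
   | |- PS (fun g => _ + _) => apply: PS_add
   | |- PS (fun g => _ - _) => apply: PS_sub
   | |- PS (fun g => _ * _) => apply: PS_mul
   | |- PS (fun g => S _) => apply: PS_succ
   | |- PS (fun g => Nat.pred _) => apply: PS_pred
   | |- PS _ => ps_leaf
   end; ps ].

(** * Words as numbers *)

Lemma bit0 x : nbit 0 x = odd x.
Proof. by rewrite /nbit divn1. Qed.

Lemma bitS i x : nbit i.+1 x = nbit i x./2.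
Proof. by rewrite /nbit expnS divnMA divn2. Qed.

Lemma bit_ge N i x : x < 2 ^ N -> N <= i -> nbit i x = false.
Proof.
move=> xN Ni; rewrite /nbit divn_small //.
by rewrite (leq_trans xN) // leq_exp2l.
Qed.

Lemma bit_le i x : nbit i x -> 2 ^ i <= x.
Proof. by rewrite /nbit; case: leqP => // lt; rewrite divn_small. Qed.

Lemma exists_bits N (v : nat -> bool) :
  exists2 x, x < 2 ^ N & forall i, i < N -> nbit i x = v i.
Proof.
elim: N v => [|N IH] v; first by exists 0.
have [x xN Hx] := IH (fun i => v i.+1).
exists (v 0 + x.*2); first by rewrite expnS; case: (v 0); lia.
case=> [|i] iN; first by rewrite bit0; case: (v 0); lia.
rewrite bitS -Hx //; congr nbit; case: (v 0); lia.
Qed.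

Lemma bit_pred_exp2 N i : nbit i (2 ^ N).-1 = (i < N).
Proof.
elim: N i => [|N IH] [|i]; rewrite ?bit0 ?bitS ?expnS //.
- by rewrite /nbit div0n.
- by have := expn_gt0 2 N; lia.
have -> : (2 * 2 ^ N).-1./2 = (2 ^ N).-1 by have := expn_gt0 2 N; lia.
by rewrite IH.
Qed.

(** Searching for one more than a set position makes the default value 0 of the search the right
    answer for [y = 0]. *)
Definition bitlen (y : nat) : nat := bsome y.+2 (fun i => (0 < i) && nbit i.-1 y).

Lemma bitlen_exp2 N : bitlen (2 ^ N).-1 = N.
Proof.
case: N => [|N] //; rewrite /bitlen; set y := (_ ^ _).-1.
pose P i := (0 < i) && nbit i.-1 y.
have ley : N.+1 < y.+2.
  have := ltn_expl N.+1 (isT : 1 < 2); rewrite /y; lia.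
have PN : P N.+1 by rewrite /P /y bit_pred_exp2 ltnSn.
have [_ /andP[_]] := bsomeP ley PN; have := bsome_max ley PN.
rewrite -/P {2}/y bit_pred_exp2; case: (bsome _ P) => //= i; lia.
Qed.

Lemma exp2_bitlen_le y : 2 ^ bitlen y <= y.*2.+1.
Proof.
case E : (bitlen y) => [|i] //.
suff /andP[_ /bit_le] : (0 < bitlen y) && nbit (bitlen y).-1 y by rewrite E expnS /=; lia.
rewrite /bitlen in E *; elim: y.+2 E => //= n IH.
by case: ifP => // Pn _.
Qed.

Lemma PS_get k t : PS (fun g : E k => Eget g t).
Proof.
elim: k => [|k IH] /=; first exact: PS_const.
by case: eqP => _; [exact: PS_var | exact: PS_weaken IH].
Qed.

Lemma PS_sum k (s : seq nat) (F : nat -> E k -> nat) :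
  (forall t, PS (F t)) -> PS (fun g => \sum_(t <- s) F t g).
Proof.
move=> HF; elim: s => [|t s IH].
  by apply: PS_ext (@PS_const _ 0) => g; rewrite big_nil.
by apply: PS_ext (PS_add (HF t) IH) => g; rewrite big_cons.
Qed.

Lemma PB_all k (s : seq nat) (P : nat -> E k -> bool) :
  (forall t, PB (P t)) -> PB (fun g => all (fun t => P t g) s).
Proof.
move=> HP; elim: s => [|t s IH] /=; first exact: PB_const.
exact: PB_and.
Qed.

Lemma Eget_map s k t : t < k -> Eget (Emap s (Eiota k)) t = s t.
Proof. by elim: k => //= k IH; rewrite ltnS leq_eqVlt; case: eqP => [->|_ /IH]. Qed.

Lemma bit_track (Sigma : finType) (idx : Sigma -> nat) a0 w t i :
  nbit i (track_num idx w t) = (i < size w) && (idx (nth a0 w i) == t).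
Proof.
elim: w i => [|a w IH] [|i] /=; rewrite ?bit0 ?bitS //.
- by rewrite /nbit div0n.
- by case: eqP => _; lia.
- by rewrite -IH; congr nbit; case: eqP => _; lia.
Qed.

(** Each position carries exactly one letter, so the tracks add up without carries to a number of
    [size w] ones. This is how the length of the input is recovered. *)
Lemma sum_track (Sigma : finType) (idx : Sigma -> nat) k w : (forall a, idx a < k) ->
  \sum_(t <- iota 0 k) track_num idx w t = (2 ^ size w).-1.
Proof.
move=> idxk; elim: w => [|a w IH]; first by rewrite big1.
rewrite /= big_split /= -[X in _ + X]/(\sum_(t <- iota 0 k) (track_num idx w t).*2).
under [X in _ + X]eq_bigr do rewrite -mul2n.
rewrite -big_distrr /= IH expnS.
have -> : \sum_(i <- iota 0 k) (idx a == i) = 1.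
  rewrite (bigD1_seq (idx a)) ?iota_uniq ?mem_iota //= eqxx big1 // => i.
  by rewrite eq_sym => /negbTE->.
by have := expn_gt0 2 (size w); lia.
Qed.

(* The word is presented to [alg] as one number [x] whose bit [k * i + t] says that
   letter [i] has index [t]; its length, 2^length and a larger bound come along. *)
Theorem in_PSPACE_of_code (Sigma : finType) (a0 : Sigma) (idx : Sigma -> nat) (k : nat)
    (Lang : seq Sigma -> Prop) (alg : nat -> nat -> nat -> nat -> bool) :
  (forall a, idx a < k) ->
  (forall j, PB (fun g : E j.+4 => alg g.1.1.1.2 g.1.1.2 g.1.2 g.2)) ->
  (forall w x,
    (forall i t, t < k -> nbit (k * i + t) x = (i < size w) && (idx (nth a0 w i) == t)) ->
    alg (2 ^ ((size w + k) * (size w + k))) (2 ^ size w) (size w) x <-> Lang w) ->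
  in_PSPACE Lang.
Proof.
move=> idxk Halg HL.
pose Y (g : E k) := \sum_(t <- iota 0 k) Eget g t.
(* The packed word is searched for: its bits must agree with the tracks on the first [k * L]
   positions and vanish from there up to the length of the search bound. *)
pose top (g : E k) Q M L x :=
  all (fun t => ball L (fun i => nbit (k * i + t) x == nbit i (Eget g t))) (iota 0 k)
  && ball ((L + k) * (L + k)) (fun j => (k * L <= j) ==> ~~ nbit j x) && alg Q M L x.
(* The exponent dominates [k * L], as the packed word requires; being quadratic, it also leaves
   [alg] a bound large enough for codes of sets of pairs of positions. *)
pose F (g : E k) := bex (2 ^ ((bitlen (Y g) + k) * (bitlen (Y g) + k)))
  (top g (2 ^ ((bitlen (Y g) + k) * (bitlen (Y g) + k))) (Y g).+1 (bitlen (Y g))).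
apply: (@in_PSPACE_of_PS _ idx k Lang (fun g => F g)) => //.
- have HY : PS Y by apply: PS_sum => t; apply: PS_get.
  have Hl : PS (fun g => bitlen (Y g)) by rewrite /bitlen; ps.
  have HQ : PS (fun g => 2 ^ ((bitlen (Y g) + k) * (bitlen (Y g) + k))).
    (* Doubling [Y g] makes up for [2 ^ bitlen y] exceeding [y] by a factor of up to two. *)
    apply: (@PS_exp2_sq _ (fun g => bitlen (Y g) + k) (fun g => (Y g + Y g + 1) * 2 ^ k)); try ps.
    by move=> g; rewrite expnD leq_mul2r addnn addn1 exp2_bitlen_le orbT.
  have body : PB (fun g : E k.+3 => bex g.1.1.2 (top g.1.1.1 g.1.1.2 g.1.2 g.2)).
    apply: PB_bex; first by ps.
    rewrite /top; apply: PB_and; first apply: PB_and.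
    + apply: (@PB_all k.+4 (iota 0 k) (fun t g =>
        ball g.1.2 (fun i => nbit (k * i + t) g.2 == nbit i (Eget g.1.1.1.1 t)))) => t.
      by have Ht := @PS_get k t; ps.
    + by ps.
    + exact: (Halg k).
  have HM : PS (fun g : E k.+1 => (Y g.1).+1) by ps.
  have HL2 : PS (fun g : E k.+2 => bitlen (Y g.1.1)) by exact: PS_weaken (PS_weaken Hl).
  (* [Halg] covers [alg] on variables only, so the three computed arguments are bound one after the
     other. *)
  exact: (PS_let (h := fun g Q => bex Q (top g Q (Y g).+1 (bitlen (Y g)))) HQ
    (PS_let (h := fun (g : E k.+1) M => bex g.2 (top g.1 g.2 M (bitlen (Y g.1)))) HM
    (PS_let (h := fun (g : E k.+2) L => bex g.1.2 (top g.1.1 g.1.2 g.2 L)) HL2 body))).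
- move=> w; rewrite /F.
  set g := Emap _ _.
  have eY : Y g = (2 ^ size w).-1.
    rewrite -(sum_track w idxk) /Y !big_seq; apply: eq_bigr => t.
    by rewrite mem_iota => tk; rewrite Eget_map.
  have eM : (Y g).+1 = 2 ^ size w by rewrite eY prednK // expn_gt0.
  rewrite eM eY bitlen_exp2; set N := size w.
  have kN : k * N <= (N + k) * (N + k) by nia.
  have codeE i t : t < k -> k * i + t < k * N = (i < N).
    by move=> tk; apply/idP/idP; nia.
  split.
    rewrite lt0b => /bexP[x xQ /andP[/andP[/allP H1 /ballP H2] Hx]].
    apply/(HL w x) => // i t tk; have [iN|Ni] := ltnP i N.
      have := H1 t; rewrite mem_iota => /(_ tk) /ballP/(_ i iN)/eqP->.
      by rewrite Eget_map // (bit_track _ a0) iN.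
    have [lt|ge] := ltnP (k * i + t) ((N + k) * (N + k)); last exact: bit_ge xQ ge.
    apply: negbTE; apply: (implyP (H2 _ lt)).
    by rewrite leqNgt codeE // -leqNgt.
  move=> Hw; rewrite lt0b.
  have k0 : 0 < k by apply: leq_ltn_trans (idxk a0).
  have [x xN Hx] := exists_bits (k * N)
    (fun j => (j %/ k < N) && (idx (nth a0 w (j %/ k)) == j %% k)).
  have Hx' i t : t < k -> nbit (k * i + t) x = (i < size w) && (idx (nth a0 w i) == t).
    move=> tk; have [iN|Ni] := ltnP i N.
      by rewrite Hx ?codeE // mulnC divnMDl // divn_small // addn0 modnMDl modn_small // iN.
    by rewrite (bit_ge xN) // leqNgt codeE // -leqNgt.
  apply/bexP; exists x; first by rewrite (leq_trans xN) ?leq_exp2l.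
  apply/andP; split; last exact/(HL w x).
  apply/andP; split.
    apply/allP => t; rewrite mem_iota => tk; apply/ballP => i iN.
    by rewrite Hx' // Eget_map // (bit_track _ a0).
  by apply/ballP => j _; apply/implyP => kj; rewrite (bit_ge xN).
Qed.

(** * The decision procedure *)

Definition tok_idx (t : tok) : nat :=
  match t with TAtom => 0 | TNAtom => 1 | TAnd => 2 | TOr => 3
   | TX => 4 | TF => 5 | TG => 6 | TU => 7 | TR => 8 | TOne => 9
   | TZero => 10 | TSep => 11 end.

Definition is_tok (x t i : nat) : bool := nbit (12 * i + t) x.

Definition is_unary (x i a : nat) : bool :=
  ball a (fun y => is_tok x 9 (i + y)) && is_tok x 11 (i + a).

(* [C] codes a set of pairs (i, j), meant to say that tokens i, ..., j-1 form a formula. *)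
Definition parsed (L C i j : nat) : bool := nbit (i * L.+1 + j) C.

(** Token index 3, the splitjunction, is left out, which confines parses to the fragment. In the
    atom case [i + a + 2] counts the atom token, [a] ones and the separator. *)
Definition parse_step (A x L C i j : nat) : bool :=
  [|| (is_tok x 0 i || is_tok x 1 i) &&
        bex A (fun a => (j == i + a + 2) && is_unary x i.+1 a),
      (is_tok x 4 i || is_tok x 5 i || is_tok x 6 i) && parsed L C i.+1 j |
      (is_tok x 2 i || is_tok x 7 i || is_tok x 8 i) &&
        bex L.+1 (fun m => parsed L C i.+1 m && parsed L C m j)].

(** One implication is enough: [C] may omit formulas, but each of its entries has to be justified by
    further entries. *)
Definition parse_ok (A x L C e : nat) : bool :=
  parsed L C 0 e && ball L.+1 (fun i => ball L.+1 (fun j =>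
    parsed L C i j ==> parse_step A x L C i j)).

(** The tables begin at [e + n + i0 + 2], after two unary numbers with their separators. The
    equation for [L] excludes trailing tokens, and the last conjunct is left-totality. *)
Definition kripke_ok (A x L e n i0 : nat) : bool :=
  [&& is_unary x e n, is_unary x (e + n + 1) i0, i0 < n,
      L == e + n + i0 + 2 + n * n + n * A,
      ball (n * n + n * A) (fun y => is_tok x 9 (e + n + i0 + 2 + y) ||
                                     is_tok x 10 (e + n + i0 + 2 + y)) &
      ball n (fun i => bex n (fun j => is_tok x 9 (e + n + i0 + 2 + (i * n + j))))].

(** A world set is an [n]-bit number. Searching below [M = 2 ^ L] finds it, as a structure with [n]
    worlds has an encoding longer than [n]. *)
Definition worlds_init (M n i0 : nat) : nat :=
  bsome M (fun S => ball n (fun j => nbit j S == (j == i0))).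

Definition worlds_step (M x n b S : nat) : nat :=
  bsome M (fun S' => ball n (fun j =>
    nbit j S' == bex n (fun i => nbit i S && is_tok x 9 (b + (i * n + j))))).

Definition worlds (M x n b i0 k : nat) : nat :=
  nrec (worlds_init M n i0) (fun _ S => worlds_step M x n b S) k.

(** The second operand starts where the first one ends; in a correct parse that end is unique,
    because formulas form a prefix code. *)
Definition second_val (L C V i : nat) : bool :=
  bex L (fun m => [&& i < m, parsed L C i.+1 m & nbit m V]).

Definition atom_val (A x n b i S : nat) (pos : bool) : bool :=
  bex A (fun a => is_unary x i.+1 a &&
    ball n (fun y => nbit y S ==> (is_tok x 9 (b + n * n + (y * A + a)) == pos))).

(* [V] and [V'] hold the truth values, one bit per token position, at times k and k+1. *)
Definition val_rhs (A M L x n b C k S V' V i : nat) : bool :=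
  [|| is_tok x 0 i && atom_val A x n b i S true,
      is_tok x 1 i && atom_val A x n b i S false,
      is_tok x 2 i && (nbit i.+1 V && second_val L C V i),
      is_tok x 4 i && nbit i.+1 V',
      is_tok x 5 i && (nbit i.+1 V || ((k.+1 < i.+1 * M) && nbit i V')),
      is_tok x 6 i && (nbit i.+1 V && ((k.+1 < i.+1 * M) ==> nbit i V')),
      is_tok x 7 i && (second_val L C V i ||
                       (nbit i.+1 V && ((k.+1 < i.+1 * M) && nbit i V'))) |
      is_tok x 8 i && (second_val L C V i &&
                       (nbit i.+1 V || ((k.+1 < i.+1 * M) ==> nbit i V')))].

Definition val_step (A M L x n b C k S V' : nat) : nat :=
  bsome M (fun V => ball L (fun i => nbit i V == val_rhs A M L x n b C k S V' V i)).

(** Round [t] treats time [L * M - t.+1]. The start value 0 at time [L * M] is arbitrary: the bit at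
    position [i] is relied upon only up to time [i * M]. *)
Definition val_run (A M L x n b C i0 t : nat) : nat :=
  nrec 0 (fun t V' => val_step A M L x n b C (L * M - t.+1)
                        (worlds M x n b i0 (L * M - t.+1)) V') t.

Definition decide (A Q M L x : nat) : bool :=
  bex Q (fun C => bex L.+1 (fun e => bex L.+1 (fun n => bex L.+1 (fun i0 =>
    [&& parse_ok A x L C e, kripke_ok A x L e n i0 &
        nbit 0 (val_run A M L x n (e + n + i0 + 2) C i0 (L * M))])))).

(** Each round ends in a search below [M], which supplies the bound on intermediate values that the
    recursion demands. *)
Lemma PS_worlds k (M x n b i0 t : E k -> nat) :
  PS M -> PS x -> PS n -> PS b -> PS i0 -> PS t ->
  PS (fun g => worlds (M g) (x g) (n g) (b g) (i0 g) (t g)).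
Proof.
move=> HM Hx Hn Hb Hi Ht.
apply: (PS_rec_bounded (B := M) Ht (z := fun g => worlds_init (M g) (n g) (i0 g))
  (h := fun g _ S => worlds_step (M g) (x g) (n g) (b g) S)).
- by rewrite /worlds_init; ps.
- by rewrite /worlds_step /is_tok; ps.
- exact: PS_pbounded.
- by move=> g [|i] _; apply: bsome_le.
Qed.

Lemma PS_val_step k A (M L x n b C t S V : E k -> nat) :
  PS M -> PS L -> PS x -> PS n -> PS b -> PS C -> PS t -> PS S -> PS V ->
  PS (fun g => val_step A (M g) (L g) (x g) (n g) (b g) (C g) (t g) (S g) (V g)).
Proof.
move=> HM HL Hx Hn Hb HC Ht HS HV.
rewrite /val_step /val_rhs /atom_val /second_val /is_unary /parsed /is_tok; ps.
Qed.

Lemma PS_val_run k A (M L x n b C i0 t : E k -> nat) :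
  PS M -> PS L -> PS x -> PS n -> PS b -> PS C -> PS i0 -> PS t ->
  PS (fun g => val_run A (M g) (L g) (x g) (n g) (b g) (C g) (i0 g) (t g)).
Proof.
move=> HM HL Hx Hn Hb HC Hi Ht.
apply: (PS_rec_bounded (B := M) Ht (z := fun=> 0) (h := fun g t V =>
  val_step A (M g) (L g) (x g) (n g) (b g) (C g) (L g * M g - t.+1)
    (worlds (M g) (x g) (n g) (b g) (i0 g) (L g * M g - t.+1)) V)).
- by ps.
- have H : PS (fun g : E k.+2 => L g.1.1 * M g.1.1 - g.1.2.+1) by ps.
  by apply: PS_val_step => //; try ps; apply: PS_worlds => //; ps.
- exact: PS_pbounded.
- by move=> g [|i] _; [|apply: bsome_le].
Qed.

Lemma PB_decide k A : PB (fun g : E k.+4 => decide A g.1.1.1.2 g.1.1.2 g.1.2 g.2).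
Proof.
rewrite /decide.
do 4 (apply: PB_bex; first by ps).
apply: PB_and; first by rewrite /parse_ok /parse_step /is_unary /parsed /is_tok; ps.
apply: PB_and; first by rewrite /kripke_ok /is_unary /is_tok; ps.
by apply: PB_bit; [ps | apply: PS_val_run; ps].
Qed.

(** * Formulas on sequences of world sets *)

Lemma unary_cat_inj a a' (r r' : seq tok) :
  unary a ++ r = unary a' ++ r' -> a = a' /\ r = r'.
Proof.
rewrite /unary !cat_rcons; elim: a a' => [|a IH] [|a'] //= [].
  by move=> ->.
by move=> /IH[-> ->].
Qed.

(** Polish notation is a prefix code. The remainders are general because the first operand of a
    binary operator is followed by the second. *)
Lemma enc_ltl_cat_inj (AP : finType) (f f' : ltl AP) r r' :
  enc_ltl f ++ r = enc_ltl f' ++ r' -> f = f' /\ r = r'.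
Proof.
elim: f f' r r' => [p|p|a IHa b IHb|a IHa b IHb|a IHa|a IHa|a IHa|a IHa b IHb|a IHa b IHb]
  [p'|p'|a' b'|a' b'|a'|a'|a'|a' b'|a' b'] r r' //= [].
1-2: by move=> /unary_cat_inj[/val_inj/enum_rank_inj-> ->].
all: try by move=> /IHa[-> ->].
all: by rewrite -!catA => /IHa[-> /IHb[-> ->]].
Qed.

Lemma enc_ltl_gt0 (AP : finType) (f : ltl AP) : 0 < size (enc_ltl f).
Proof. by case: f. Qed.

Lemma eq_bex n (P Q : pred nat) : (forall i, i < n -> P i = Q i) -> bex n P = bex n Q.
Proof.
move=> H; apply/bexP/bexP => -[i lt Pi]; exists i => //; first by rewrite -H.
by rewrite H.
Qed.

Lemma eq_ball n (P Q : pred nat) : (forall i, i < n -> P i = Q i) -> ball n P = ball n Q.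
Proof.
move=> H; apply/ballP/ballP => HP i lt; first by rewrite -H // HP.
by rewrite H // HP.
Qed.

Definition until (d : nat) (A B : pred nat) : bool :=
  bex d (fun q => B q && ball q A).

Lemma untilS d A B :
  until d.+1 A B = B 0 || (A 0 && until d (fun q => A q.+1) (fun q => B q.+1)).
Proof.
apply/bexP/orP => [[[|q] lt /andP[Bq /ballP Aq]]|[B0|/andP[A0 /bexP[q lt /andP[Bq /ballP Aq]]]]].
- by left.
- right; rewrite Aq //=; apply/bexP; exists q => //; rewrite Bq.
  by apply/ballP => i iq; apply: Aq.
- by exists 0 => //; rewrite B0.
- exists q.+1 => //; rewrite Bq; apply/ballP => -[|i] iq //; exact: Aq.
Qed.

Lemma eq_until d (A A' B B' : pred nat) :
  A =1 A' -> B =1 B' -> until d A B = until d A' B'.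
Proof.
move=> eA eB; apply: eq_bex => q _; rewrite eB; congr andb.
by apply: eq_ball => i _; rewrite eA.
Qed.

(* Backward evaluation of an until whose value is reset to false at time [H]. *)
Lemma backward_until (v A B : nat -> bool) H k :
  (forall k, k < H -> v k = B k || (A k && ((k.+1 < H) && v k.+1))) ->
  (k < H) && v k = until (H - k) (fun q => A (k + q)) (fun q => B (k + q)).
Proof.
move=> Hv; elim: {k}(H - k) {-2}k (erefl (H - k)) => [|d IH] k e; rewrite e.
  by have -> : k < H = false by lia.
have kH : k < H by lia.
have e1 : H - k.+1 = d by lia.
rewrite kH /= Hv // untilS !addn0 IH // e1.
congr (_ || (_ && _)); apply: eq_until => q; by rewrite addnS addSn.
Qed.

(** * Suffix teams as world sets *)

Section Semantics.
Variables (AP : finType) (K : kripke AP).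
Hypothesis K_total : left_total K.
Notation worldset := {set 'I_(kn K)}.

Definition post (S : worldset) : worldset :=
  [set v | [exists u in S, krel K u v]].

Definition traces_from (S : worldset) : team AP := fun t =>
  exists pi : nat -> 'I_(kn K), pi 0 \in S /\
    (forall i, krel K (pi i) (pi i.+1)) /\ (forall i, t i = klab K (pi i)).

Lemma team_ext (T T' : team AP) : (forall t, T t <-> T' t) -> T = T'.
Proof.
by move=> H; apply: functional_extensionality => t; apply: propositional_extensionality.
Qed.

Lemma suffixD (k l : nat) (t : trace AP) : Defs.suffix k (Defs.suffix l t) = Defs.suffix (k + l) t.
Proof. by apply: functional_extensionality => i; rewrite /Defs.suffix addnCA addnA. Qed.

Lemma team_suffix0 (T : team AP) : team_suffix 0 T = T.
Proof. by apply: team_ext => t; split => [[s [Ts ->]]|Tt] //; exists t. Qed.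

Lemma team_suffixD k l (T : team AP) :
  team_suffix k (team_suffix l T) = team_suffix (k + l) T.
Proof.
apply: team_ext => t; split=> [[s [[u [Tu ->]] ->]]|[u [Tu ->]]].
  by exists u; rewrite suffixD.
by exists (Defs.suffix l u); split; [exists u | rewrite suffixD].
Qed.

(** Dropping the first world of a path from [S] leaves a path from [post S], and each path from
    [post S] is extended backwards by a predecessor in [S]. So suffix teams never leave the family
    [traces_from]. *)
Lemma team_suffix_traces_from k S :
  team_suffix k (traces_from S) = traces_from (iter k post S).
Proof.
elim: k => [|k IH]; first exact: team_suffix0.
rewrite -add1n -team_suffixD IH /=; set S' := iter _ _ _.
apply: team_ext => t; split.
  move=> [s [[pi [pi0 [Hpi Hs]]] ->]]; exists (fun i => pi i.+1); split.
    by rewrite inE; apply/existsP; exists (pi 0); rewrite pi0 Hpi.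
  by split=> i; [exact: Hpi | rewrite /Defs.suffix Hs].
move=> [pi [pi0 [Hpi Ht]]]; move: pi0; rewrite inE => /existsP[u /andP[uS uv]].
pose pi' i := if i is i'.+1 then pi i' else u.
exists (fun i => klab K (pi' i)); split; last first.
  by apply: functional_extensionality => i; rewrite /Defs.suffix /= Ht.
by exists pi'; split=> //; split=> // -[|i] //=.
Qed.

(** Left-totality enters here: every world of [S] starts an infinite path, so a literal that holds
    on the team holds at each world of [S]. *)
Lemma traces_from_inhabited (S : worldset) v : v \in S ->
  exists2 t, traces_from S t & t 0 = klab K v.
Proof.
move=> vS; pose nxt u := odflt u [pick u' | krel K u u'].
have nxtP u : krel K u (nxt u).
  by rewrite /nxt; case: pickP => //= H; have [u'] := K_total u; rewrite H.
exists (fun i => klab K (iter i nxt v)) => //.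
by exists (fun i => iter i nxt v); split=> //; split=> // i; apply: nxtP.
Qed.

Lemma traces_of_from : traces_of K = traces_from [set kinit K].
Proof.
apply: team_ext => t; split=> -[pi [pi0 H]]; exists pi; split=> //.
  by rewrite pi0 set11.
by move: pi0; rewrite inE => /eqP.
Qed.

(* Among more positions than world sets two carry the same set, so a shortest
   witness of an until lies in a window of that length. *)
Lemma until_window (N : nat) (P Q : pred worldset) S : 2 ^ kn K <= N ->
  (exists q, Q (iter q post S) /\ forall i, i < q -> P (iter i post S)) <->
  until N (fun i => P (iter i post S)) (fun q => Q (iter q post S)).
Proof.
move=> leN; split; last first.
  by move=> /bexP[q _ /andP[Qq /ballP Pq]]; exists q.
move=> [q0 [Q0 P0]].
pose R q := Q (iter q post S) && ball q (fun i => P (iter i post S)).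
have exR : exists q, R q by exists q0; rewrite /R Q0; apply/ballP.
case: (ex_minnP exR) => q Rq minq; apply/bexP; exists q => //.
have /andP[Qq /ballP Pq] := Rq.
rewrite ltnNge; apply/negP => Nq.
pose F (i : 'I_q.+1) := iter i post S.
have : ~~ injectiveb F.
  apply/negP => /injectiveP/leq_card; rewrite card_ord.
  have -> : #|{: worldset}| = 2 ^ kn K.
    by rewrite -cardsT -powersetT card_powerset cardsT card_ord.
  by lia.
move=> /injectivePn[i [j ij Fij]].
wlog lt : i j ij Fij / i < j.
  move=> H; have [lt|lt|e] := ltngtP i j; first exact: (H i j).
    by apply: (H j i); rewrite // eq_sym.
  by move: ij; rewrite -val_eqE /= e eqxx.
have jq : j <= q by rewrite -ltnS.
(* Positions [i] and [j] carry the same set, so cutting out the stretch between them leads to the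
   same final set with a smaller witness. *)
have e : iter (q - (j - i)) post S = iter q post S.
  have -> : q - (j - i) = (q - j) + i by lia.
  by rewrite iterD [iter i _ _]Fij -iterD subnK.
have : R (q - (j - i)).
  by rewrite /R e Qq; apply/ballP => y yq; apply: Pq; lia.
by move=> /minq; lia.
Qed.

Variable N : nat.
Hypothesis leN : 2 ^ kn K <= N.

(** All four temporal operators are bounded untils, [G] and [R] in negated form, so a single window
    argument and a single reset argument serve them all. The value at [LOr] is a dummy outside the
    fragment. *)
Fixpoint holds (f : ltl AP) (S : worldset) : bool :=
  match f with
  | LAtom p => [forall v in S, p \in klab K v]
  | LNAtom p => [forall v in S, p \notin klab K v]
  | LAnd a b => holds a S && holds b S
  | LOr _ _ => false
  | LX a => holds a (post S)
  | LF a => until N predT (fun q => holds a (iter q post S))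
  | LG a => ~~ until N predT (fun q => ~~ holds a (iter q post S))
  | LU a b => until N (fun i => holds a (iter i post S)) (fun q => holds b (iter q post S))
  | LR a b => ~~ until N (fun i => ~~ holds a (iter i post S))
                         (fun q => ~~ holds b (iter q post S))
  end.

Lemma sat_holds f S : splitjunction_free f -> sat_s f (traces_from S) <-> holds f S.
Proof.
elim: f S => [p|p|a IHa b IHb|a IHa b IHb|a IHa|a IHa|a IHa|a IHa b IHb|a IHa b IHb] S //=.
- move=> _; split=> [H|/forallP H t [pi [pi0 [_ Ht]]]].
    apply/forallP => v; apply/implyP => vS.
    by have [t Tt <-] := traces_from_inhabited vS; apply: H.
  by rewrite Ht; apply: (implyP (H _)).
- move=> _; split=> [H|/forallP H t [pi [pi0 [_ Ht]]]].
    apply/forallP => v; apply/implyP => vS.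
    by have [t Tt <-] := traces_from_inhabited vS; apply: H.
  by rewrite Ht; apply: (implyP (H _)).
- by move=> /andP[/IHa Ha /IHb Hb]; rewrite Ha Hb; split=> /andP.
- by move=> /IHa Ha; rewrite team_suffix_traces_from; apply: Ha.
- move=> /IHa Ha; rewrite -(until_window predT (holds a) S leN); split=> -[k].
    by rewrite team_suffix_traces_from => /Ha H; exists k.
  by move=> [/Ha H _]; exists k; rewrite team_suffix_traces_from.
- move=> /IHa Ha; split=> [H|/negP H k].
    apply/negP => /(until_window predT (predC (holds a)) S leN)[k [/negP nk _]].
    by apply/nk/Ha; rewrite -team_suffix_traces_from.
  rewrite team_suffix_traces_from; apply/Ha; apply/negPn/negP => nk; apply: H.
  by apply/(until_window predT (predC (holds a)) S leN); exists k.
- move=> /andP[/IHa Ha /IHb Hb]; rewrite -(until_window (holds a) (holds b) S leN).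
  split=> -[k [Hk Hlt]]; exists k; split.
  + by apply/Hb; rewrite -team_suffix_traces_from.
  + by move=> i ik; apply/Ha; rewrite -team_suffix_traces_from; apply: Hlt.
  + by rewrite team_suffix_traces_from; apply/Hb.
  + by move=> i ik; rewrite team_suffix_traces_from; apply/Ha; apply: Hlt.
- move=> /andP[/IHa Ha /IHb Hb]; split=> [H|/negP H k].
    apply/negP => /(until_window (predC (holds a)) (predC (holds b)) S leN)[k [/negP nb na]].
    case: (H k) => [|[i [ik]]]; rewrite team_suffix_traces_from.
      by move=> /Hb.
    by move=> /Ha Hi; have /negP := na i ik.
  have [Hk|nk] := boolP (holds b (iter k post S)).
    by left; rewrite team_suffix_traces_from; apply/Hb.
  right.
  have [/bexP[i ik Hi]|nex] := boolP (bex k (fun i => holds a (iter i post S))).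
    by exists i; split=> //; rewrite team_suffix_traces_from; apply/Ha.
  case: H; apply/(until_window (predC (holds a)) (predC (holds b)) S leN).
  exists k; split=> // i ik; apply/negP => Hi; move/negP: nex; apply.
  by apply/bexP; exists i.
Qed.

End Semantics.

(** * Correctness of the decision procedure *)

Arguments ball : simpl never.
Arguments bex : simpl never.
Arguments bsome : simpl never.

Lemma tok_idx_lt t : tok_idx t < 12.
Proof. by case: t. Qed.

Lemma tok_idx_inj : injective tok_idx.
Proof. by case; case. Qed.

Lemma ballS n P : ball n.+1 P = P 0 && ball n (fun i => P i.+1).
Proof.
apply/ballP/andP => [H|[P0 /ballP H] [|i] //]; last exact: H.
by split; [exact: H | apply/ballP => i lt; apply: H].
Qed.

Lemma drop_cat_eq (T : Type) i (w s1 s2 : seq T) :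
  drop i w = s1 ++ s2 -> drop (i + size s1) w = s2.
Proof. by move=> e; rewrite addnC -drop_drop e drop_size_cat. Qed.

(** Excluded middle lets a predicate that quantifies over formulas be coded by bits. It serves to
    show that a code exists, not to compute one. *)
Lemma exists_bits_prop N (P : nat -> Prop) :
  exists2 x, x < 2 ^ N & forall i, i < N -> nbit i x <-> P i.
Proof.
have [x xN Hx] := exists_bits N (fun i => if excluded_middle_informative (P i) then true else false).
by exists x => // i iN; rewrite Hx //; case: excluded_middle_informative; split.
Qed.

Lemma nth_flatten_const (T : Type) (x0 : T) (ss : seq (seq T)) m i q :
  (forall s, List.In s ss -> size s = m) -> q < m ->
  nth x0 (flatten ss) (i * m + q) = nth x0 (nth [::] ss i) q.
Proof.
move=> + qm; elim: ss i => [|s ss IH] i Hm; first by rewrite !nth_nil.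
have sm : size s = m by apply: Hm; left.
rewrite /= nth_cat sm; case: i => [|i] /=; first by rewrite mul0n add0n qm.
rewrite mulSn -addnA ltnNge leq_addr /= addKn; apply: IH => s' Hs'.
by apply: Hm; right.
Qed.

Lemma nth_allpairs_enum (T : finType) (R : Type) (x0 : R) n (F : 'I_n -> T -> R)
    (i : 'I_n) (j : T) :
  nth x0 [seq F i j | i <- enum 'I_n, j <- enum T] (i * #|T| + enum_rank j) = F i j.
Proof.
rewrite nth_flatten_const ?ltn_ord //.
  rewrite (nth_map i) ?size_enum_ord // nth_ord_enum.
  by rewrite (nth_map j) -?cardE ?ltn_ord // nth_enum_rank.
move=> s; elim: (enum 'I_n) => //= a r IH [<-|/IH//].
by rewrite size_map -cardE.
Qed.

Definition tables (AP : finType) (K : kripke AP) : seq tok :=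
  [seq bit (krel K i j) | i <- enum 'I_(kn K), j <- enum 'I_(kn K)] ++
  [seq bit (a \in klab K i) | i <- enum 'I_(kn K), a <- enum AP].

Section Tables.
Variables (AP : finType) (K : kripke AP).
Notation n := (kn K).
Notation A := #|AP|.

Lemma size_tables : size (tables K) = n * n + n * A.
Proof. by rewrite size_cat !size_allpairs -!cardE card_ord. Qed.

Lemma nth_tables_rel (i j : 'I_n) :
  nth TSep (tables K) (i * n + j) = bit (krel K i j).
Proof.
have lt : i * n + j < n * n by have := ltn_ord i; have := ltn_ord j; nia.
rewrite nth_cat size_allpairs -!cardE card_ord lt.
rewrite -(nth_allpairs_enum TSep (fun i j => bit (krel K i j)) i j).
by congr nth; rewrite enum_rank_ord /= card_ord.
Qed.

Lemma nth_tables_lab (i : 'I_n) (p : AP) :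
  nth TSep (tables K) (n * n + (i * A + enum_rank p)) = bit (p \in klab K i).
Proof.
rewrite nth_cat size_allpairs -!cardE card_ord ltnNge leq_addr /= addKn.
exact: (nth_allpairs_enum TSep (fun i a => bit (a \in klab K i)) i p).
Qed.

Lemma tables_pos y : y < n * n + n * A ->
  (exists i j : 'I_n, y = i * n + j) \/
  (exists (i : 'I_n) (p : AP), y = n * n + (i * A + enum_rank p)).
Proof.
move=> yN; have [lt|ge] := ltnP y (n * n).
  have n0 : 0 < n by case: (n) lt => //; rewrite muln0.
  have di : y %/ n < n by rewrite ltn_divLR.
  left; exists (Ordinal di), (Ordinal (ltn_pmod y n0)) => /=.
  exact: divn_eq.
have lt : y - n * n < n * A by lia.
have A0 : 0 < A by case: (A) lt => //; rewrite muln0.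
have di : (y - n * n) %/ A < n by rewrite ltn_divLR.
right; exists (Ordinal di), (enum_val (Ordinal (ltn_pmod (y - n * n) A0))) => /=.
by rewrite enum_valK /= -divn_eq; lia.
Qed.

End Tables.

(** * Reading formulas and structures back from a coded word *)

Section Coded.
Variables (w : seq tok) (x : nat).
Notation L := (size w).
Hypothesis code_x : forall i t, t < 12 ->
  nbit (12 * i + t) x = (i < L) && (tok_idx (nth TSep w i) == t).

Lemma is_tokE t i : is_tok x (tok_idx t) i = (i < L) && (nth TSep w i == t).
Proof.
by rewrite /is_tok code_x ?tok_idx_lt // (inj_eq tok_idx_inj).
Qed.

Lemma is_tok_drop t i : is_tok x (tok_idx t) i -> drop i w = t :: drop i.+1 w.
Proof. by rewrite is_tokE => /andP[iL /eqP <-]; rewrite (drop_nth TSep iL). Qed.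

Lemma drop_cons_lt i (t : tok) s : drop i w = t :: s -> i < L.
Proof. by move=> e; rewrite ltnNge; apply/negP => /drop_oversize; rewrite e. Qed.

Lemma drop_consS i (t : tok) s : drop i w = t :: s -> drop i.+1 w = s.
Proof. by rewrite -cat1s => /drop_cat_eq; rewrite addn1. Qed.

Lemma drop_is_tok t t' i s : drop i w = t :: s -> is_tok x (tok_idx t') i = (t == t').
Proof.
move=> e; rewrite is_tokE (drop_cons_lt e) /=; congr (_ == _).
by have := congr1 (fun s => nth TSep s 0) e; rewrite nth_drop addn0.
Qed.

Lemma is_unaryS i a : is_unary x i a.+1 = is_tok x 9 i && is_unary x i.+1 a.
Proof.
rewrite /is_unary ballS addn0 andbA addSnnS; congr (_ && _ && _).
by apply: eq_ball => y _; rewrite addSnnS.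
Qed.

Lemma is_unary_drop i a : is_unary x i a ->
  i + a < L /\ drop i w = unary a ++ drop (i + a + 1) w.
Proof.
elim: a i => [|a IH] i.
  rewrite /is_unary /= addn0 => /(@is_tok_drop TSep) e.
  by rewrite (drop_cons_lt e) e addn1.
rewrite is_unaryS => /andP[/(@is_tok_drop TOne) e /IH[lt e2]].
by rewrite e e2 addSnnS in lt *.
Qed.

Lemma drop_is_unary i a s : drop i w = unary a ++ s -> is_unary x i a.
Proof.
elim: a i => [|a IH] i e.
  by rewrite /is_unary /= addn0 (drop_is_tok TSep e).
by rewrite is_unaryS (drop_is_tok TOne e) eqxx (IH i.+1 (drop_consS e)).
Qed.

Section Parse.
Variable AP : finType.
Notation A := #|AP|.
Variables (C e : nat).
Hypothesis C_ok : parse_ok A x L C e.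

Lemma parse_stepP i j : i <= L -> j <= L -> parsed L C i j -> parse_step A x L C i j.
Proof.
case/andP: C_ok => _ /ballP H iL jL p.
by have /ballP/(_ j jL)/implyP := H i iL; apply.
Qed.

Lemma parsed_sound i j : i <= L -> j <= L -> parsed L C i j ->
  i < j /\ exists2 f : ltl AP, splitjunction_free f & drop i w = enc_ltl f ++ drop j w.
Proof.
(* A justification refers only to entries that start further right, so circular entries in [C] are
   impossible and the distance from the end is a measure. *)
have [N leN] := ubnP (L - i); elim: N i j leN => [//|N IH] i j leN iL jL p.
have iL' : i < L.
  have := parse_stepP iL jL p; rewrite /parse_step.
  rewrite !(is_tokE TAtom, is_tokE TNAtom, is_tokE TX, is_tokE TF, is_tokE TG,
    is_tokE TAnd, is_tokE TU, is_tokE TR) /=.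
  by case: (i < L).
have leN' m : i < m -> L - m < N by lia.
have := parse_stepP iL jL p; rewrite /parse_step => /or3P[].
- move=> /andP[t /bexP[a aA /andP[/eqP ej /is_unary_drop[lt eu]]]].
  have ea : i.+1 + a + 1 = j by lia.
  rewrite ea in eu; split; first by lia.
  have eu' : drop i.+1 w = unary (enum_rank (enum_val (Ordinal aA))) ++ drop j w.
    by rewrite enum_valK.
  case/orP: t => [/(@is_tok_drop TAtom)|/(@is_tok_drop TNAtom)] e'; rewrite e' eu'.
    by exists (LAtom (enum_val (Ordinal aA))).
  by exists (LNAtom (enum_val (Ordinal aA))).
- move=> /andP[t p1]; have [lt [f sf ef]] := IH _ _ (leN' _ (ltnSn i)) iL' jL p1.
  split; first by lia.
  case/orP: t => [/orP[]|] t.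
  + by exists (LX f); rewrite ?(is_tok_drop (t := TX) t) ?ef.
  + by exists (LF f); rewrite ?(is_tok_drop (t := TF) t) ?ef.
  + by exists (LG f); rewrite ?(is_tok_drop (t := TG) t) ?ef.
- move=> /andP[t /bexP[m mL /andP[p1 p2]]].
  have [lt1 [f sf ef]] := IH _ _ (leN' _ (ltnSn i)) iL' mL p1.
  have [lt2 [g sg eg]] := IH _ _ (leN' _ (ltnW lt1)) mL jL p2.
  split; first by lia.
  case/orP: t => [/orP[]|] t.
  + by exists (LAnd f g); rewrite /= ?sf ?(is_tok_drop (t := TAnd) t) ?ef ?eg //= catA.
  + by exists (LU f g); rewrite /= ?sf ?(is_tok_drop (t := TU) t) ?ef ?eg //= catA.
  + by exists (LR f g); rewrite /= ?sf ?(is_tok_drop (t := TR) t) ?ef ?eg //= catA.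
Qed.

End Parse.

Lemma parse_ok_exists (AP : finType) (f : ltl AP) s :
  splitjunction_free f -> w = enc_ltl f ++ s ->
  exists2 C, C < 2 ^ (L.+1 * L.+1) & parse_ok #|AP| x L C (size (enc_ltl f)).
Proof.
move=> sf ew.
(* The witness is the largest parse: all pairs that delimit the encoding of some formula of the
   fragment. *)
pose P i j := exists2 g : ltl AP, splitjunction_free g & drop i w = enc_ltl g ++ drop j w.
have [C CN HC] := exists_bits_prop (L.+1 * L.+1) (fun q => P (q %/ L.+1) (q %% L.+1)).
exists C => //.
have HP i j : i <= L -> j <= L -> parsed L C i j <-> P i j.
  move=> iL jL; rewrite /parsed HC; last by nia.
  by rewrite divnMDl // divn_small // addn0 modnMDl modn_small.
have sL : size (enc_ltl f) <= L by rewrite [in X in _ <= X]ew size_cat leq_addr.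
rewrite /parse_ok; apply/andP; split.
  apply/HP => //; exists f => //; rewrite drop0 {1}ew; congr (_ ++ _).
  by rewrite {1}ew drop_size_cat.
apply/ballP => i; rewrite ltnS => iL; apply/ballP => j; rewrite ltnS => jL.
apply/implyP => /(HP _ _ iL jL)[g sg eg].
have sizes := congr1 size eg; rewrite size_cat !size_drop in sizes.
have sub_case (a b : ltl AP) t : splitjunction_free a && splitjunction_free b ->
    drop i w = t :: enc_ltl a ++ enc_ltl b ++ drop j w ->
    bex L.+1 (fun m => parsed L C i.+1 m && parsed L C m j).
  move=> /andP[sa sb] e; have e1 := drop_consS e; have e2 := drop_cat_eq e1.
  have lt := drop_cons_lt e.
  have mL : i.+1 + size (enc_ltl a) <= L.
    by have := congr1 size e1; rewrite size_cat size_drop; have := enc_ltl_gt0 a; lia.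
  apply/bexP; exists (i.+1 + size (enc_ltl a)) => //; apply/andP; split.
    by apply/HP => //; exists a => //; rewrite e1 e2.
  by apply/HP => //; exists b.
have one_case (a : ltl AP) t : splitjunction_free a ->
    drop i w = t :: enc_ltl a ++ drop j w -> parsed L C i.+1 j.
  move=> sa e; have e1 := drop_consS e; have lt := drop_cons_lt e.
  by apply/HP => //; exists a.
have atom_case (p : AP) t : drop i w = t :: unary (enum_rank p) ++ drop j w ->
    bex #|AP| (fun a => (j == i + a + 2) && is_unary x i.+1 a).
  move=> e; apply/bexP; exists (enum_rank p); first exact: ltn_ord.
  rewrite (drop_is_unary (drop_consS e)) andbT.
  have := congr1 size e; rewrite /= size_cat /unary size_rcons size_nseq !size_drop.
  by have := drop_cons_lt e; lia.
rewrite /parse_step.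
case: g sg eg {sizes} => [p|p|a b|a b|a|a|a|a b|a b] //= sg eg; rewrite -?catA in eg.
- by rewrite (drop_is_tok TAtom eg) eqxx (atom_case _ _ eg).
- by rewrite (drop_is_tok TNAtom eg) eqxx orbT (atom_case _ _ eg).
- by rewrite (drop_is_tok TAnd eg) eqxx (sub_case _ _ _ sg eg) !orbT.
- by rewrite (drop_is_tok TX eg) eqxx (one_case _ _ sg eg) !orbT.
- by rewrite (drop_is_tok TF eg) eqxx (one_case _ _ sg eg) !orbT.
- by rewrite (drop_is_tok TG eg) eqxx (one_case _ _ sg eg) !orbT.
- by rewrite (drop_is_tok TU eg) eqxx (sub_case _ _ _ sg eg) !orbT.
- by rewrite (drop_is_tok TR eg) eqxx (sub_case _ _ _ sg eg) !orbT.
Qed.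

Lemma bit_eq_TOne b : (bit b == TOne) = b.
Proof. by case: b; rewrite /= ?eqxx //; apply/eqP. Qed.

Section KripkeCode.
Variable AP : finType.
Notation A := #|AP|.

Section TableFacts.
Variables (K : kripke AP) (b : nat).
Hypothesis dropb : drop b w = tables K.
Notation n := (kn K).

Lemma is_tok_table t y : y < n * n + n * A ->
  is_tok x (tok_idx t) (b + y) = (nth TSep (tables K) y == t).
Proof.
move=> yN; rewrite is_tokE -dropb nth_drop.
have := congr1 size dropb; rewrite size_drop size_tables => e.
by have -> : b + y < L by lia.
Qed.

Lemma is_tok_rel (i j : 'I_n) : is_tok x 9 (b + (i * n + j)) = krel K i j.
Proof.
rewrite (is_tok_table TOne) ?nth_tables_rel ?bit_eq_TOne //.
by have := ltn_ord i; have := ltn_ord j; nia.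
Qed.

Lemma is_tok_lab (i : 'I_n) (p : AP) :
  is_tok x 9 (b + n * n + (i * A + enum_rank p)) = (p \in klab K i).
Proof.
rewrite -addnA (is_tok_table TOne) ?nth_tables_lab ?bit_eq_TOne //.
have qA : enum_rank p < A by exact: ltn_ord.
have := ltn_ord i; move: (nat_of_ord (enum_rank p)) qA => q qA; nia.
Qed.

End TableFacts.

Lemma kripke_ok_enc (K : kripke AP) e :
  left_total K -> e <= L -> drop e w = enc_kripke K ->
  kripke_ok A x L e (kn K) (kinit K) /\ drop (e + kn K + kinit K + 2) w = tables K.
Proof.
move=> tot eL e1; set n := kn K; set i0 := kinit K.
have e2 : drop (e + n + 1) w = unary i0 ++ tables K.
  have := drop_cat_eq e1; rewrite size_rcons size_nseq => <-.
  by congr drop; lia.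
have e3 : drop (e + n + i0 + 2) w = tables K.
  have := drop_cat_eq e2; rewrite size_rcons size_nseq => <-.
  by congr drop; lia.
split=> //.
have eL' : L = e + n + i0 + 2 + n * n + n * A.
  have := congr1 size e1; rewrite /enc_kripke size_drop !size_cat -size_cat.
  rewrite -/(tables K) size_tables !size_rcons !size_nseq -/n -/i0; lia.
rewrite /kripke_ok (drop_is_unary e1) (drop_is_unary e2) ltn_ord -eL' eqxx /=.
apply/andP; split; apply/ballP => y yN.
  rewrite (is_tok_table e3 TOne) // (is_tok_table e3 TZero) //.
  case: (tables_pos yN) => [[i [j ->]]|[i [p ->]]].
    by rewrite nth_tables_rel; case: (krel K i j); rewrite /= eqxx ?orbT.
  by rewrite nth_tables_lab; case: (p \in _); rewrite /= eqxx ?orbT.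
have [v yv] := tot (Ordinal yN).
by apply/bexP; exists v => //; rewrite (is_tok_rel e3 (Ordinal yN) v).
Qed.

Lemma kripke_ok_dec e n i0 : kripke_ok A x L e n i0 ->
  exists K : kripke AP, [/\ left_total K, kn K = n, kinit K = i0 :> nat &
    drop e w = enc_kripke K].
Proof.
move=> /and5P[u1 u2 lt /eqP eL /andP[/ballP Ht /ballP Htot]].
set b := e + n + i0 + 2 in Ht Htot eL.
pose K := @Kripke AP n (fun i j => is_tok x 9 (b + (i * n + j)))
  (fun i => [set p | is_tok x 9 (b + n * n + (i * A + enum_rank p))]) (Ordinal lt).
exists K; split=> //.
  move=> u; have /bexP[v vn Hv] := Htot u (ltn_ord u).
  by exists (Ordinal vn).
have [_ ->] := is_unary_drop u1.
have [_ ->] := is_unary_drop u2.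
congr (_ ++ (_ ++ _)).
have -> : e + n + 1 + i0 + 1 = b by rewrite /b; lia.
have sz : size (drop b w) = size (tables K) by rewrite size_tables size_drop [X in X - _]eL -addnA addKn.
apply: (@eq_from_nth _ TSep) => // y; rewrite sz => yN; rewrite size_tables in yN.
(* A table token is [TOne] or [TZero], so the test for [TOne] determines it. *)
have tokb : forall c, is_tok x (tok_idx TOne) (b + y) = c -> nth TSep (drop b w) y = bit c.
  move=> c <-; rewrite nth_drop; have := Ht y yN.
  rewrite !(is_tokE TOne, is_tokE TZero).
  by case/orP => /andP[-> /eqP->]; rewrite ?eqxx //=; case: eqP.
case: (tables_pos yN) => [[i [j ey]]|[i [p ey]]].
  by rewrite [in RHS]ey -/(tables K) nth_tables_rel; apply: tokb; rewrite ey.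
rewrite [in RHS]ey -/(tables K) nth_tables_lab; apply: tokb.
by rewrite ey inE addnA.
Qed.

End KripkeCode.

(** * Values computed by the backward sweep *)

Section Run.
Variables (AP : finType) (K : kripke AP) (C e b : nat).
Notation A := #|AP|.
Notation n := (kn K).
Notation M := (2 ^ L).
Hypothesis dropb : drop b w = tables K.

Lemma kn_le : n <= L.
Proof.
have := congr1 size dropb; rewrite size_drop size_tables.
by have := ltn_ord (kinit K); nia.
Qed.

Hypothesis C_ok : parse_ok A x L C e.

Lemma bsome_bits N (v : nat -> bool) : N <= L ->
  forall j, j < N -> nbit j (bsome M (fun S => ball N (fun j => nbit j S == v j))) = v j.
Proof.
move=> NL; have [S SN HS] := exists_bits N v.
have SM : S < M by rewrite (leq_trans SN) // leq_exp2l.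
have PS : ball N (fun j => nbit j S == v j) by apply/ballP => j jN; rewrite HS.
have [_ /ballP H] := @bsomeP M (fun S => ball N (fun j => nbit j S == v j)) S SM PS.
by move=> j jN; apply/eqP; apply: H.
Qed.

Definition reachable k : {set 'I_n} := iter k (@post _ K) [set kinit K].

Lemma worlds_reachable k (y : 'I_n) :
  nbit y (worlds M x n b (kinit K) k) = (y \in reachable k).
Proof.
elim: k y => [|k IH] y.
  by rewrite [worlds _ _ _ _ _ _]/= bsome_bits ?kn_le // inE -val_eqE.
rewrite -[worlds _ _ _ _ _ k.+1]/(worlds_step M x n b (worlds M x n b (kinit K) k)).
rewrite /worlds_step.
rewrite (@bsome_bits n (fun j => bex n (fun i => nbit i (worlds M x n b (kinit K) k) &&
  is_tok x 9 (b + (i * n + j))))) ?kn_le //.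
rewrite /reachable iterS inE; apply/bexP/existsP => [[i lt]|[i]] /andP[Hi Hij].
  exists (Ordinal lt).
  by rewrite -(is_tok_rel dropb (Ordinal lt) y) Hij andbT -IH.
exists i => //; rewrite IH -/(reachable k) in Hi *.
by rewrite Hi (is_tok_rel dropb).
Qed.

(** At the current time only operands are consulted, and these start to the right of [i]; in
    [second_val] the conjunct [i < m] ensures it. *)
Lemma val_rhs_congr k S V' V1 V2 i :
  (forall j, i < j -> nbit j V1 = nbit j V2) ->
  val_rhs A M L x n b C k S V' V1 i = val_rhs A M L x n b C k S V' V2 i.
Proof.
move=> H; have e2 : second_val L C V1 i = second_val L C V2 i.
  by apply: eq_bex => m _; case: ltnP => //= im; rewrite H.
by rewrite /val_rhs e2 H.
Qed.

(** [V] occurs on both sides of the equations, but bit [i] depends only on later bits of [V], so a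
    solution is built from the last position downwards. The search in [val_step] then succeeds. *)
Lemma val_step_exists k S V' : exists2 V, V < M &
  forall i, i < L -> nbit i V = val_rhs A M L x n b C k S V' V i.
Proof.
suff H : forall d, d <= L -> exists2 V, V < M &
    forall i, L - d <= i < L -> nbit i V = val_rhs A M L x n b C k S V' V i.
  have [V VM HV] := H L (leqnn L).
  by exists V => // i iL; apply: HV; rewrite subnn.
elim=> [|d IH] dL.
  by exists 0 => [|i]; [rewrite expn_gt0 | lia].
have [V VM HV] := IH (ltnW dL).
pose i0 := L - d.+1.
have [V2 V2M HV2] := exists_bits L
  (fun j => if j == i0 then val_rhs A M L x n b C k S V' V i0 else nbit j V).
have agree j : i0 < j -> nbit j V2 = nbit j V.
  move=> lt; have [jL|Lj] := ltnP j L; last by rewrite !(bit_ge _ Lj).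
  by rewrite HV2 //; case: eqP => // ej; lia.
exists V2 => // i /andP[ige iL].
have [ei|ne] := eqVneq i i0.
  rewrite (@val_rhs_congr k S V' V2 V) => [|j ij]; last by apply: agree; lia.
  by rewrite HV2 // ei eqxx.
rewrite (@val_rhs_congr k S V' V2 V) => [|j ij]; last by apply: agree; lia.
by rewrite HV2 // (negbTE ne) HV //; lia.
Qed.

Definition vals k := val_run A M L x n b C (kinit K) (L * M - k).

Lemma valsE k i : k < L * M -> i < L ->
  nbit i (vals k) = val_rhs A M L x n b C k (worlds M x n b (kinit K) k)
                            (vals k.+1) (vals k) i.
Proof.
move=> kN iL; rewrite /vals.
have et : L * M - k = (L * M - k.+1).+1 by lia.
have ek : L * M - (L * M - k.+1).+1 = k by lia.
rewrite et -[val_run _ _ _ _ _ _ _ _ _.+1]/(val_step _ _ _ _ _ _ _ (L * M - (L * M - k.+1).+1)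
  (worlds M x n b (kinit K) (L * M - (L * M - k.+1).+1))
  (val_run A M L x n b C (kinit K) (L * M - k.+1))) ek.
set S := worlds _ _ _ _ _ _; set V' := val_run _ _ _ _ _ _ _ _ _.
have [V VM HV] := val_step_exists k S V'.
have PV : ball L (fun i => nbit i V == val_rhs A M L x n b C k S V' V i).
  by apply/ballP => j jL; rewrite HV.
have [_ /ballP H] := @bsomeP M (fun V => ball L (fun i => nbit i V == val_rhs A M L x n b C k S V' V i)) V VM PV.
by apply/eqP; apply: H.
Qed.

Lemma val_rhs_tok t s k S V' V i : drop i w = t :: s ->
  val_rhs A M L x n b C k S V' V i =
  match t with
  | TAtom => atom_val A x n b i S true
  | TNAtom => atom_val A x n b i S false
  | TAnd => nbit i.+1 V && second_val L C V i
  | TX => nbit i.+1 V'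
  | TF => nbit i.+1 V || ((k.+1 < i.+1 * M) && nbit i V')
  | TG => nbit i.+1 V && ((k.+1 < i.+1 * M) ==> nbit i V')
  | TU => second_val L C V i || (nbit i.+1 V && ((k.+1 < i.+1 * M) && nbit i V'))
  | TR => second_val L C V i && (nbit i.+1 V || ((k.+1 < i.+1 * M) ==> nbit i V'))
  | _ => false
  end.
Proof.
move=> ei; rewrite /val_rhs.
rewrite !(drop_is_tok TAtom ei, drop_is_tok TNAtom ei, drop_is_tok TAnd ei, drop_is_tok TX ei,
  drop_is_tok TF ei, drop_is_tok TG ei, drop_is_tok TU ei, drop_is_tok TR ei).
have tokE (t1 t2 : tok) : (t1 == t2) = (tok_idx t1 == tok_idx t2) by rewrite (inj_eq tok_idx_inj).
by rewrite !tokE; case: t {ei} => /=; rewrite ?orbF.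
Qed.

Lemma atom_valE i k (p : AP) s pos : drop i.+1 w = unary (enum_rank p) ++ s ->
  atom_val A x n b i (worlds M x n b (kinit K) k) pos =
  [forall v in reachable k, (p \in klab K v) == pos].
Proof.
move=> e1; apply/bexP/forallP => [[a aA /andP[/is_unary_drop[_ e2] /ballP H]] v|H].
  move: e2; rewrite e1 => /unary_cat_inj[ea _].
  apply/implyP => vS; have := H v (ltn_ord v).
  by rewrite worlds_reachable vS /= -ea (is_tok_lab dropb).
exists (enum_rank p); first exact: ltn_ord.
rewrite (drop_is_unary e1); apply/ballP => y yn.
rewrite -[y]/(val (Ordinal yn)) worlds_reachable (is_tok_lab dropb).
exact: H.
Qed.

Lemma parse_step_tok t s i j : drop i w = t :: s ->
  parse_step A x L C i j =
  match t with
  | TAtom | TNAtom => bex A (fun a => (j == i + a + 2) && is_unary x i.+1 a)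
  | TX | TF | TG => parsed L C i.+1 j
  | TAnd | TU | TR => bex L.+1 (fun m => parsed L C i.+1 m && parsed L C m j)
  | _ => false
  end.
Proof.
move=> ei; rewrite /parse_step.
rewrite !(drop_is_tok TAtom ei, drop_is_tok TNAtom ei, drop_is_tok TAnd ei, drop_is_tok TX ei,
  drop_is_tok TF ei, drop_is_tok TG ei, drop_is_tok TU ei, drop_is_tok TR ei).
have tokE (t1 t2 : tok) : (t1 == t2) = (tok_idx t1 == tok_idx t2) by rewrite (inj_eq tok_idx_inj).
by rewrite !tokE; case: t {ei} => /=; rewrite ?orbF.
Qed.

(** Two candidate ends of the first operand leave the same remainder of the word, by the prefix
    code, and suffixes of equal length start at the same position. *)
Lemma second_valE (g h : ltl AP) i j s :
  i < L -> j <= L -> drop i.+1 w = enc_ltl g ++ enc_ltl h ++ s ->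
  bex L.+1 (fun m => parsed L C i.+1 m && parsed L C m j) ->
  exists m, [/\ i < m < L, parsed L C i.+1 m, parsed L C m j,
    drop m w = enc_ltl h ++ s & forall V, second_val L C V i = nbit m V].
Proof.
move=> iL jL e1 /bexP[m mL /andP[p1 p2]].
have uniq m' : m' <= L -> parsed L C i.+1 m' -> i.+1 < m' /\ drop m' w = enc_ltl h ++ s.
  move=> mL' /(parsed_sound C_ok iL mL')[lt [g' _ e2]]; split=> //.
  by move: e2; rewrite e1 => /enc_ltl_cat_inj[_ <-].
have [im em] := uniq m mL p1.
have lt : m < L.
  have := congr1 size em; rewrite size_drop size_cat; have := enc_ltl_gt0 h; lia.
exists m; split=> //; first by rewrite (ltnW im).
move=> V; apply/bexP/idP => [[m' mL' /and3P[im' p1' Vm']]|Vm]; last first.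
  by exists m => //; rewrite (ltnW im) p1.
have [_ em'] := uniq m' (ltnW mL') p1'.
have := congr1 size em'; rewrite -em !size_drop => es.
by have -> : m = m' by lia.
Qed.

Lemma eq_until_in d (P P' Q Q' : pred nat) :
  (forall q, q < d -> P q = P' q) -> (forall q, q < d -> Q q = Q' q) ->
  until d P Q = until d P' Q'.
Proof.
move=> eP eQ; apply: eq_bex => q qd; rewrite eQ //; congr andb.
by apply: eq_ball => i iq; rewrite eP // (ltn_trans iq).
Qed.

Lemma reachableD k q : reachable (k + q) = iter q (@post _ K) (reachable k).
Proof. by rewrite /reachable addnC iterD. Qed.

(* The reset at [H] leaves a window of [M] positions, which is all an until needs. *)
Lemma until_correct i k (v P Q : pred nat) (P' Q' : pred {set 'I_n}) :
  k <= i * M ->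
  (forall k, k < i.+1 * M -> v k = Q k || (P k && ((k.+1 < i.+1 * M) && v k.+1))) ->
  (forall k, k < i.+1 * M -> P k = P' (reachable k)) ->
  (forall k, k < i.+1 * M -> Q k = Q' (reachable k)) ->
  v k = until M (fun q => P' (iter q (@post _ K) (reachable k)))
                (fun q => Q' (iter q (@post _ K) (reachable k))).
Proof.
move=> ki Hv HP HQ; have M0 : 0 < M by rewrite expn_gt0.
have kH : k < i.+1 * M by rewrite mulSn; lia.
have := backward_until k Hv; rewrite kH /= => ->.
rewrite (@eq_until_in _ _ (fun q => P' (iter q (@post _ K) (reachable k)))
   _ (fun q => Q' (iter q (@post _ K) (reachable k)))).
- have le1 : 2 ^ n <= M by rewrite leq_exp2l // kn_le.
  have le2 : 2 ^ n <= i.+1 * M - k by rewrite mulSn; lia.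
  (* Both windows have length at least [2 ^ n], so either bounded until is equivalent to the
     unbounded one. *)
  by apply/idP/idP => /until_window-/(_ ltac:(assumption)) H; apply/until_window.
- by move=> q qd; rewrite HP ?reachableD //; lia.
- by move=> q qd; rewrite HQ ?reachableD //; lia.
Qed.

(** The encoding at [i] identifies the formula, while the entry of [C] guarantees that the
    evaluation finds its second operand. The induction keeps [i] and [k] general because operands
    are needed at other positions and times. *)
Lemma vals_holds (f : ltl AP) i j s :
  splitjunction_free f -> i <= L -> j <= L -> parsed L C i j ->
  drop i w = enc_ltl f ++ s -> forall k, k <= i * M ->
  nbit i (vals k) = holds M f (reachable k).
Proof.
have Mgt0 : 0 < M by rewrite expn_gt0.
have below i' k' : i' < L -> k' < i'.+1 * M -> k' < L * M.
  by move=> lt /leq_trans; apply; rewrite leq_mul2r lt orbT.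
elim: f i j s => [p|p|g IHg h IHh|g IHg h IHh|g IHg|g IHg|g IHg|g IHg h IHh|g IHg h IHh]
  i j s //= sf iL jL pij ei k ki; rewrite -?catA in ei;
  have iL' := drop_cons_lt ei; have e1 := drop_consS ei;
  (have kH : k < i.+1 * M by rewrite mulSn; lia);
  have eV k' : k' < i.+1 * M -> _ := fun lt =>
    etrans (valsE (below i k' iL' lt) iL') (val_rhs_tok _ _ _ _ ei);
  have pst := parse_stepP C_ok iL jL pij; rewrite (parse_step_tok j ei) in pst.
- rewrite eV // (atom_valE _ _ e1).
  by apply: eq_forallb => v; rewrite eqb_id.
- rewrite eV // (atom_valE _ _ e1).
  by apply: eq_forallb => v; rewrite eqbF_neg.
- have /andP[sg sh] := sf.
  have [m [/andP[im mL] p1 p2 em sE]] := second_valE iL' jL e1 pst.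
  have km : k <= m * M by apply: leq_trans (ltnW kH) _; rewrite leq_mul2r im orbT.
  by rewrite eV // sE (IHg _ _ _ sg iL' (ltnW mL) p1 e1) ?(ltnW kH) // (IHh _ _ _ sh (ltnW mL) jL p2 em).
(* [X] has no reset: it reads its operand at [k.+1], which is still at most [i.+1 * M]. *)
- by rewrite eV // (IHg _ _ _ sf iL' jL pst e1).
- apply: (until_correct (v := fun k => nbit i (vals k)) (P := predT) (P' := predT)
    (Q := fun k => nbit i.+1 (vals k)) (Q' := holds M g) ki) => // k' lt /=.
  by rewrite (IHg _ _ _ sf iL' jL pst e1) // ltnW.
(* Under negation the default true after the reset becomes the default false of an until; the
   release case is dual in the same way. *)
- apply: (canRL negbK).
  apply: (until_correct (v := fun k => ~~ nbit i (vals k)) (P := predT) (P' := predT)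
    (Q := fun k => ~~ nbit i.+1 (vals k)) (Q' := fun S => ~~ holds M g S) ki) => // k' lt /=.
    by rewrite eV // negb_and negb_imply.
  by rewrite (IHg _ _ _ sf iL' jL pst e1) // ltnW.
- have /andP[sg sh] := sf.
  have [m [/andP[im mL] p1 p2 em sE]] := second_valE iL' jL e1 pst.
  have km k' : k' < i.+1 * M -> k' <= m * M.
    by move=> /ltnW/leq_trans; apply; rewrite leq_mul2r im orbT.
  apply: (until_correct (v := fun k => nbit i (vals k)) (P := fun k => nbit i.+1 (vals k))
    (P' := holds M g) (Q := fun k => nbit m (vals k)) (Q' := holds M h) ki) => // k' lt /=.
  + by rewrite eV // sE.
  + by rewrite (IHg _ _ _ sg iL' (ltnW mL) p1 e1) // ltnW.
  + by rewrite (IHh _ _ _ sh (ltnW mL) jL p2 em) // km.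
- have /andP[sg sh] := sf.
  have [m [/andP[im mL] p1 p2 em sE]] := second_valE iL' jL e1 pst.
  have km k' : k' < i.+1 * M -> k' <= m * M.
    by move=> /ltnW/leq_trans; apply; rewrite leq_mul2r im orbT.
  apply: (canRL negbK).
  apply: (until_correct (v := fun k => ~~ nbit i (vals k)) (P := fun k => ~~ nbit i.+1 (vals k))
    (P' := fun S => ~~ holds M g S) (Q := fun k => ~~ nbit m (vals k))
    (Q' := fun S => ~~ holds M h S) ki) => // k' lt /=.
  + by rewrite eV // sE negb_and negb_or negb_imply.
  + by rewrite (IHg _ _ _ sg iL' (ltnW mL) p1 e1) // ltnW.
  + by rewrite (IHh _ _ _ sh (ltnW mL) jL p2 em) // km.
Qed.

End Run.

End Coded.

Theorem mainTheorem8 (AP : finType) :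
  in_PSPACE (TMCs_splitjunction_free AP).
Proof.
apply: (@in_PSPACE_of_code tok TSep tok_idx 12 (TMCs_splitjunction_free AP)
  (fun Q M L x => decide #|AP| Q M L x)).
- exact: tok_idx_lt.
- by move=> k; apply: PB_decide.
move=> w x code_x; rewrite /decide; split.
  move=> /bexP[C _ /bexP[e eL /bexP[n _ /bexP[i0 _ /and3P[Cok Kok V0]]]]].
  have C0e : parsed (size w) C 0 e by case/andP: Cok.
  have [_ [f sf ef]] := parsed_sound code_x Cok (leq0n _) eL C0e.
  have [K [totK nK iK eK]] := kripke_ok_dec code_x Kok.
  rewrite -{}nK -{}iK in V0.
  have [_ dropb] := kripke_ok_enc code_x totK eL eK.
  (* The whole formula sits at position 0, whose value is relied upon at time 0 only, and this is
     the time of the full team. *)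
  have := vals_holds code_x dropb Cok sf (leq0n _) eL C0e ef (leq0n _).
  rewrite /vals subn0 V0 => /esym H.
  exists f, K; split; first by rewrite /enc_instance -eK -ef drop0.
  split=> //; split=> //; rewrite traces_of_from; apply/(sat_holds totK (N := 2 ^ size w)) => //.
  by rewrite leq_exp2l // (kn_le dropb).
move=> [f [K [ew [totK [sf Hsat]]]]].
set e := size (enc_ltl f).
have eL : e <= size w by rewrite ew size_cat leq_addr.
have [C CN Cok] := parse_ok_exists code_x sf ew.
have eK : drop e w = enc_kripke K by rewrite ew drop_size_cat.
have [Kok dropb] := kripke_ok_enc code_x totK eL eK.
have nL := kn_le dropb.
(* The exponent [(size w + 12) ^ 2] of the search bound covers the [(size w + 1) ^ 2] bits of
   [C]. *)
apply/bexP; exists C; first by rewrite (leq_trans CN) // leq_exp2l // leq_mul // -addn1 leq_add2l.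
apply/bexP; exists e => //.
apply/bexP; exists (kn K) => //.
apply/bexP; exists (kinit K); first by rewrite ltnS (leq_trans (ltnW (ltn_ord _))).
have C0e : parsed (size w) C 0 e by case/andP: Cok.
have ef : drop 0 w = enc_ltl f ++ enc_kripke K by rewrite drop0.
rewrite Cok Kok /=.
have := vals_holds code_x dropb Cok sf (leq0n _) eL C0e ef (leq0n _).
rewrite /vals subn0 => ->.
apply/(sat_holds totK (N := 2 ^ size w)) => //; first by rewrite leq_exp2l.
by rewrite -traces_of_from.
Qed.
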